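(* Let $\mu$ be a compactly supported Borel probability measure on $\mathrm{SL}(2,\mathbb{R})$ which is strongly irreducible and proximal. Let $t\in(t_c,0]$. For all $\alpha\in\mathrm{A}$ and $\gamma\in[0,2]$, $$I_\gamma(\alpha)+t(1-\gamma)\alpha\le k(t)-\zeta_t\gamma\alpha.$$
   Context: Setting. $\mu$ is a compactly supported Borel probability measure on $\mathrm{SL}(2,\mathbb{R})$; $S_\mu$ is the closed semigroup generated by $\operatorname{supp}\mu$. $\mu$ is strongly irreducible if there is no nonempty finite collection of proper nonzero subspaces of $\mathbb{R}^2$ that is $S_\mu$-invariant, and proximal if $S_\mu$ contains an element whose leading eigenvalue (i.e. of maximal modulus) is simple. $\mu^n$ is the $n$-th convolution power of $\mu$. Notation. $\mathbb{P}:=\mathbb{RP}^1$, $d_{\mathbb{P}}(\mathbb{R}u,\mathbb{R}v):=|u\wedge v|/(|u||v|)$; $|g|$ is the spectral norm. For $|g|>1$ write $g=KDL$ with $K,L\in O_2(\mathbb{R})$, $D=\mathrm{diag}(\kappa,\kappa^{-1})$, $\kappa>1$, and set $\omega_-(g):=\mathbb{R}L^{-1}e_2$ (the line in the domain corresponding to the smallest singular value); for $|g|=1$ it is an arbitrary fixed (measurable) choice. $k(t):=\lim_{n\to\infty}\frac1n\log\int|g|^t\,d\mu^n(g)$, $t\in\mathbb{R}$. For $\alpha\ge0$, $\epsilon>0$, $n\in\mathbb{N}$, $\gamma\in[0,2]$, $x\in\mathbb{P}$: $E(\alpha,\epsilon,n):=\{g\in \mathrm{SL}(2,\mathbb{R}):|\frac1n\log|g|-\alpha|\le\epsilon\}$,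 $E_\gamma(\alpha,\epsilon,n,x):=\{g\in E(\alpha,\epsilon,n):d_{\mathbb{P}}(x,\omega_-(g))\le e^{-n(\gamma-\epsilon)\alpha}\}$, $I_\gamma(\alpha):=\lim_{\epsilon\to0}\limsup_{n\to\infty}\frac1n\log\sup_{x\in\mathbb{P}}\mu^n(E_\gamma(\alpha,\epsilon,n,x))$ (with $\log 0=-\infty$), and $\mathrm{A}:=\{\alpha: I_0(\alpha)>-\infty\}\subseteq[0,\infty)$. $t_c:=\inf\{t\in\mathbb{R}:k(t)>\sup_{\alpha\in\mathrm{A}}\{I_2(\alpha)-t\alpha\}\}$ (one has $-1\le t_c<0$). For $t\in(t_c,0]$, $\zeta_t$ is the unique solution of $\sup_{\alpha\in\mathrm{A}}\{I_2(\alpha)-t\alpha+2\zeta_t\alpha\}=k(t)$; equivalently $\zeta_t=\sup\{\zeta\in\mathbb{R}:\sup_{\alpha\in\mathrm{A}}\{I_2(\alpha)-t\alpha+2\zeta\alpha\}<k(t)\}$; one has $\zeta_t\in(0,1+t]$. *)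

(* Defs.v *)
From HB Require Import structures.
From mathcomp Require Import all_boot all_order all_algebra.
From mathcomp Require Import all_classical all_reals all_analysis.
From mathcomp Require Import measurable_realfun complex.

Set Implicit Arguments.
Unset Strict Implicit.
Unset Printing Implicit Defensive.

Import Order.TTheory GRing.Theory Num.Theory.
Import numFieldNormedType.Exports.

Local Open Scope classical_set_scope.
Local Open Scope ring_scope.

Definition SL2 (R : realType) : Type :=
  set_type [set g : 'M[R]_2 | \det g = 1].

Section SL2_structure.
Variable R : realType.

HB.instance Definition _ := Topological.on (SL2 R).

Lemma det_SL2 (g : SL2 R) : \det (val g) = 1.
Proof. by case: g => g /= /set_mem. Qed.

Definition SL2_mk (g : 'M[R]_2) (g1 : \det g = 1) : SL2 R :=
  exist (fun h => h \in [set h : 'M[R]_2 | \det h = 1]) g (mem_set g1).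

Definition SL2_one : SL2 R := SL2_mk (det1 R 2).

Fact det_SL2_mul (g h : SL2 R) : \det (val g *m val h) = 1.
Proof. by rewrite det_mulmx !det_SL2 mulr1. Qed.

Definition SL2_mul (g h : SL2 R) : SL2 R := SL2_mk (det_SL2_mul g h).

HB.instance Definition _ := isPointed.Build (SL2 R) SL2_one.

(* SL2 R carries its Borel sigma-algebra. *)
HB.instance Definition _ :=
  Measurable.copy (SL2 R) (g_sigma_algebraType (@open (SL2 R))).

End SL2_structure.

Section SL2_measurability.
Variable R : realType.

Lemma SL2_open_measurable (U : set (SL2 R)) : open U -> measurable U.
Proof. by move=> oU; exact: sub_sigma_algebra. Qed.

Lemma SL2_val_continuous : continuous (val : SL2 R -> 'M[R]_2).
Proof. exact: initial_continuous. Qed.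

Lemma measurable_SL2_entry (i j : 'I_2) :
  measurable_fun setT (fun g : SL2 R => val g i j).
Proof.
apply: (measurability _ (RGenInftyO.measurableE R)).
move=> _ [_ [a ->] <-]; rewrite setTI.
apply: SL2_open_measurable; apply: open_comp; last exact: open_lt.
move=> g _; apply: (@continuous_comp _ _ _ (val : SL2 R -> 'M[R]_2)
  (fun M : 'M[R]_2 => M i j)); first exact: SL2_val_continuous.
exact: coord_continuous.
Qed.

Lemma measurable_to_SL2 d (T : measurableType d) (f : T -> SL2 R) :
  (forall i j, measurable_fun setT (fun x => val (f x) i j)) ->
  measurable_fun setT f.
Proof.
move=> mf; apply: (@measurability _ _ T (SL2 R) setT f (@open (SL2 R))) => //.
move=> _ [_ [V oV <-] <-]; rewrite setTI.
pose box (q : 'M[rat]_2 * nat) : set 'M[R]_2 :=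
  [set M | forall i j, `|ratr (q.1 i j) - M i j| < q.2.+1%:R^-1].
have -> : f @^-1` (set_val @^-1` V) =
    \bigcup_q (if `[< box q `<=` V >] then f @^-1` (val @^-1` box q) else set0).
  apply/seteqP; split=> [x Vx|x [q _]]; last first.
    by case: ifPn => // /asboolP qV /qV.
  have /nbhs_ballP[e /= e0 eV] : nbhs (val (f x)) V by exact: open_nbhs_nbhs.
  have [n /= ne] : exists n, n.+1%:R^-1 < e / 2 :> R.
    have e20 : 0 < e / 2 by rewrite divr_gt0.
    have [n _ /(_ n (leqnn n))] := near_infty_natSinv_lt (PosNum e20).
    by exists n.
  have q_ i j : exists q : rat, `|ratr q - val (f x) i j| < n.+1%:R^-1.
    have : val (f x) i j < val (f x) i j + n.+1%:R^-1.
      by rewrite ltrDl invr_gt0.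
    move=> /rat_in_itvoo[r]; rewrite in_itv /= => /andP[r1 r2]; exists r.
    by rewrite ger0_norm ?subr_ge0 ?(ltW r1)// ltrBlDl.
  pose q := \matrix_(i < 2, j < 2) projT1 (cid (q_ i j)).
  exists (q, n) => //; case: ifPn => [_ i j|/asboolP[]].
    by rewrite /= mxE; case: cid.
  move=> M /= qM; apply: eV; split => // i j.
  rewrite /ball /=.
  have := qM i j; rewrite mxE; case: cid => r /= rx rM.
  apply: (le_lt_trans (ler_distD (ratr r) _ _)).
  rewrite (splitr e) ltrD//; first by rewrite distrC (lt_trans rx).
  exact: lt_trans rM _.
apply: countable_bigcupT_measurable => [|q]; first exact: countableP.
case: ifPn => // _.
have -> : f @^-1` (val @^-1` box q) = \bigcap_(ij in [set: 'I_2 * 'I_2])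
    (fun x => val (f x) ij.1 ij.2) @^-1` ball (ratr (q.1 ij.1 ij.2) : R) q.2.+1%:R^-1.
  apply/seteqP; split=> [x bx [i j] _|x bx i j]; first exact: bx.
  exact: (bx (i, j)).
apply: fin_bigcap_measurable => [|[i j] _]; first exact: finite_finset.
rewrite -[X in measurable X]setTI; apply: mf => //.
exact: measurable_ball.
Qed.

Lemma measurable_SL2_mul :
  measurable_fun setT (fun gh : SL2 R * SL2 R => SL2_mul gh.1 gh.2).
Proof.
apply: measurable_to_SL2 => i j /=.
under eq_fun do rewrite mxE.
apply: measurable_sum => k.
by apply: measurable_funM; apply: (measurableT_comp (@measurable_SL2_entry _ _)).
Qed.

End SL2_measurability.

Section convolution.
Variable R : realType.

Definition SL2_mulp (gh : SL2 R * SL2 R) : SL2 R := SL2_mul gh.1 gh.2.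

HB.instance Definition _ := isMeasurableFun.Build _ _ _ _
  SL2_mulp (@measurable_SL2_mul R).

Definition SL2_conv (mu nu : probability (SL2 R) R) : probability (SL2 R) R :=
  distribution (mu \x nu)%E SL2_mulp.

Fixpoint convn (mu : probability (SL2 R) R) (n : nat) : probability (SL2 R) R :=
  if n is m.+1 then SL2_conv mu (convn mu m) else \d_(SL2_one R).

End convolution.

Section random_walk.
Variables (R : realType) (mu : probability (SL2 R) R).

Definition supp_mu : set (SL2 R) :=
  [set g | forall U : set (SL2 R), open U -> U g -> (0 < mu U)%E].

Definition compactly_supported : Prop := compact supp_mu.

Definition closed_semigroup (S : set (SL2 R)) : Prop :=
  closed S /\ (forall g h, S g -> S h -> S (SL2_mul g h)).

Definition semigroup_mu : set (SL2 R) := smallest closed_semigroup supp_mu.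

Definition SL2_act (g : SL2 R) (U : {vspace 'cV[R]_2}) : {vspace 'cV[R]_2} :=
  (linfun (mulmx (val g)) @: U)%VS.

Definition strongly_irreducible : Prop :=
  ~ exists F : seq {vspace 'cV[R]_2},
      [/\ F != [::],
          forall U, U \in F -> U != 0%VS /\ U != fullv &
          forall g U, semigroup_mu g -> U \in F -> SL2_act g U \in F].

(* Eigenvalues are taken in R[i], with algebraic multiplicity. A leading
   eigenvalue that is simple dominates strictly all the others; in particular a
   pair of distinct conjugate eigenvalues does not count as simple. *)
Definition simple_leading_eigenvalue (g : 'M[R]_2) : Prop :=
  let p := char_poly (map_mx (real_complex R) g) in
  exists lam : R[i],
    mup lam p = 1%N /\ (forall z : R[i], root p z -> z != lam -> `|z| < `|lam|).

Definition proximal : Prop :=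
  exists2 g, semigroup_mu g & simple_leading_eigenvalue (val g).

End random_walk.

Section projective_line.
Variable R : realType.

Definition enorm (v : 'cV[R]_2) : R := Num.sqrt (\sum_i v i 0 ^+ 2).

Definition wedge (u v : 'cV[R]_2) : R := u 0 0 * v 1 0 - u 1 0 * v 0 0.

Definition spnorm (g : 'M[R]_2) : R :=
  sup [set enorm (g *m v) | v in [set v | enorm v = 1]].

Definition RP1 : Type := {U : {vspace 'cV[R]_2} | \dim U == 1%N}.

Definition dP (x y : RP1) : R :=
  let u := vpick (val x) in let v := vpick (val y) in
  `|wedge u v| / (enorm u * enorm v).

Lemma enormZ a v : enorm (a *: v) = `|a| * enorm v.
Proof.
rewrite /enorm -sqrtr_sqr -sqrtrM ?sqr_ge0//; congr Num.sqrt.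
by rewrite mulr_sumr; apply: eq_bigr => i _; rewrite mxE exprMn.
Qed.

Lemma dPE (x y : RP1) u v : val x = <[u]>%VS -> val y = <[v]>%VS ->
  dP x y = `|wedge u v| / (enorm u * enorm v).
Proof.
have pick (z : RP1) w : val z = <[w]>%VS ->
    exists2 a, a != 0 & vpick (val z) = a *: w.
  move=> zw; have := memv_pick (val z); rewrite {2}zw => /vlineP[a aw].
  exists a => //; apply/eqP => a0; have /eqP := valP z.
  suff /eqP -> : val z == 0%VS by rewrite dimv0.
  by rewrite -vpick0 aw a0 scale0r.
move=> /pick[a a0 xu] /pick[b b0 yv].
rewrite /dP xu yv !enormZ.
have -> : wedge (a *: u) (b *: v) = (a * b) * wedge u v.
  by rewrite /wedge !mxE mulrBr; congr (_ - _); rewrite mulrACA.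
rewrite normrM normrM mulrACA -mulf_div divff ?mul1r//.
by rewrite mulf_neq0// normr_eq0.
Qed.

Definition open_RP1 (U : set RP1) : Prop :=
  forall x, U x -> exists2 r : R, 0 < r & forall y, dP x y < r -> U y.

Definition orthogonal_mx (K : 'M[R]_2) : Prop := K *m K^T = 1%:M.

Definition diag2 (a b : R) : 'M[R]_2 :=
  diag_mx (\row_(j < 2) (if j == 0 then a else b)).

Definition e2 : 'cV[R]_2 := delta_mx 1 0.

(* The values of omega at the g with |g| = 1 are arbitrary, up to Borel
   measurability. *)
Definition is_omega_minus (omega : SL2 R -> RP1) : Prop :=
  (forall (g : SL2 R) (K L : 'M[R]_2) (kappa : R),
     1 < spnorm (val g) -> orthogonal_mx K -> orthogonal_mx L -> 1 < kappa ->
     val g = K *m diag2 kappa kappa^-1 *m L ->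
     val (omega g) = <[invmx L *m e2]>%VS) /\
  (forall U, open_RP1 U -> measurable (omega @^-1` U)).

End projective_line.

Section rate_functions.
Variables (R : realType) (mu : probability (SL2 R) R).
Variable omega : SL2 R -> RP1 R.

Definition kfun (t : R) : \bar R :=
  limn (fun n : nat =>
    (n%:R^-1)%:E * lne (\int[convn mu n]_g ((spnorm (val g) `^ t)%:E)))%E.

Definition Eset (alpha eps : R) (n : nat) : set (SL2 R) :=
  [set g | `|n%:R^-1 * ln (spnorm (val g)) - alpha| <= eps].

Definition Eset_gamma (gamma alpha eps : R) (n : nat) (x : RP1 R) : set (SL2 R) :=
  [set g | Eset alpha eps n g /\
           dP x (omega g) <= expR (- (n%:R * (gamma - eps) * alpha))].

Definition Irate (gamma alpha : R) : \bar R :=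
  lim ((limn_esup (fun n : nat => (n%:R^-1)%:E *
     lne (ereal_sup (range (fun x => convn mu n (Eset_gamma gamma alpha eps n x))))))%E
   @[eps --> 0^'+]).

Definition Aset : set R := [set alpha | 0 <= alpha /\ (-oo < Irate 0 alpha)%E].

(* t_c and zeta_t are formed in the extended reals, so that no default value is
   involved for empty or unbounded sets. *)
Definition tc : \bar R :=
  ereal_inf (EFin @` [set t : R |
    (ereal_sup [set Irate 2 alpha - (t * alpha)%:E | alpha in Aset]
       < kfun t)%E]).

Definition zeta (t : R) : \bar R :=
  ereal_sup (EFin @` [set z : R |
    (ereal_sup [set Irate 2 alpha - (t * alpha)%:E + (2 * z * alpha)%:E
                 | alpha in Aset]
       < kfun t)%E]).

End rate_functions.

(* Main.v *)
Require Import Defs.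
From mathcomp Require Import all_boot all_order all_algebra.
From mathcomp Require Import all_classical all_reals all_analysis.
From mathcomp Require Import measurable_realfun ring lra.

(* Write [|g x|] for the expansion of the line [x] under [g], and set
   [rho = |g| / |g x|], which is comparable to [min (1 / d(x, omega_-(g))) |g|^2].
   Split a random product [g = g_n ... g_1] at the last time [m] at which
   [a = g_m ... g_1] satisfies [|a|^2 <= rho]. From then on the contracted direction
   moves by [O(|a|^(-2))] per step, so [d(x, omega_-(a)) = O(n |a|^(-2))] and
   [|a|^2 ~ rho]: the factor [a] is governed by [I_2], and the remaining factor [h]
   by [sup_y int |h y|^t].

   With [c] an upper bound of [I_2(alpha) - t alpha], smaller than [k(t)], this yields
   [sup_x int |g x|^t dmu^n <= sum_m e^(m c) sup_y int |h y|^t dmu^(n-m)] up to the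
   contribution of [rho <= e^(eps n)], which is controlled by [k(t)]; induction on [n] then
   shows that the left-hand side grows at rate at most [k(t)]. Splitting a second time
   on the event [E_gamma(alpha)], where [|a|^2 >= e^(n gamma alpha)] up to subexponential
   factors, and inserting [|a|^(-t) = |a|^(-t + 2 z) |a|^(-2 z)], gains the factor
   [e^(- n z gamma alpha)] for every [z < zeta_t]. *)

(** The sign of [t] is used twice. For [t <= 0] the sequence [log int |g|^t dmu^n] is superadditive,
    so [k(t)] is a supremum and the moment bound [e^(n k(t))] holds at every [n], in a form that an
    induction on [n] can use. Moreover [|a x|^t <= |a|^(-t)], so only the norm of the first factor
    is left to integrate. The obstacle is uniformity. [I_2(alpha)] is a limit taken separately at
    each [alpha], and the factor [n] in [d(x, omega_-(a)) = O(n |a|^(-2))] refers to the full length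
    [n], not to the length [m] of [a]. Compactness of [[0, b]], where [log|a| / m] takes its values,
    removes the first dependence. The second is harmless for [m >= d' n], where [n] is
    subexponential in [m]; for shorter [a] the trivial bound [|a| <= e^(b m)] costs only [e^(dl n)].
    In the induction a threshold on [log rho] that is linear in [n] forces [m >= d' n], so every
    summand gains [e^(- m (k(t) + dl - c))], which absorbs the number of summands and the
    constants. *)

Import Order.TTheory GRing.Theory Num.Theory.
Import numFieldNormedType.Exports.

(** * Singular values in dimension two and the projective metric *)

Section linear_algebra.
Local Open Scope classical_set_scope.
Local Open Scope ring_scope.
Context {R : realType}.
Implicit Types (g h : SL2 R) (u v w : 'cV[R]_2) (x y z : RP1 R).

(** Spectral theorem for the matrix with rows [(a, c)] and [(c, d)], in coordinates: the eigenvalues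
    are [k] and [k^-1], and [(w0, w1)] is a unit eigenvector for the smaller one. *)
Lemma symmetric_spectral (a c d : R) : 0 <= a -> 0 <= d -> a * d - c ^+ 2 = 1 ->
  exists k w0 w1 : R, [/\ 1 <= k, w0 ^+ 2 + w1 ^+ 2 = 1,
    a = k * w1 ^+ 2 + k^-1 * w0 ^+ 2,
    d = k * w0 ^+ 2 + k^-1 * w1 ^+ 2 & c = (k^-1 - k) * (w0 * w1)].
Proof.
move=> a0 d0 adc.
pose T := a + d.
have T4 : 4 <= T ^+ 2 by rewrite /T; have := sqr_ge0 (a - d); have := sqr_ge0 c; nra.
have T0 : 0 <= T by rewrite addr_ge0.
have T2 : 2 <= T by rewrite /T in T4 T0 *; nra.
pose D := Num.sqrt (T ^+ 2 - 4).
have D2 : D ^+ 2 = T ^+ 2 - 4 by rewrite sqr_sqrtr ?subr_ge0.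
have D0 : 0 <= D by exact: sqrtr_ge0.
pose k := (T + D) / 2; pose l := (T - D) / 2.
have k1 : 1 <= k by rewrite /k; lra.
have kl1 : k * l = 1 by rewrite /k /l; field: D2.
have lE : k^-1 = l.
  by apply: (@mulfI _ k); rewrite ?mulfV ?kl1//; apply/eqP => k0; lra.
have kl : k - l = D by rewrite /k /l; field.
have klT : k + l = a + d by rewrite /k /l /T; field.
have pr : (a - l) * (d - l) = c ^+ 2.
  have -> : (a - l) * (d - l) = a * d - l * (a + d) + l ^+ 2 by ring.
  rewrite -klT; have -> : a * d = 1 + c ^+ 2 by lra.
  by rewrite mulrDr [l * k]mulrC kl1; ring.
have sm : (a - l) + (d - l) = D by lra.
have al0 : 0 <= a - l by nra.
have dl0 : 0 <= d - l by nra.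
exists k; rewrite lE.
(* A zero gap [D = k - l] means that the matrix is the identity, and any unit vector serves. *)
have [D00|Dn0] := eqVneq D 0.
  exists 1, 0; have al : a - l = 0 by lra.
  have dl : d - l = 0 by lra.
  move: pr; rewrite al mul0r => /esym/eqP; rewrite sqrf_eq0 => /eqP c0.
  by split=> //; lra.
have Dp : 0 < D by rewrite lt_neqAle eq_sym Dn0.
(* The squares of [w0] and [w1] are forced; [e] fixes the relative sign so that
   [w0 * w1 = - c / D]. *)
pose e : R := if 0 <= c then -1 else 1.
have e2 : e ^+ 2 = 1 by rewrite /e; case: ifP => _; rewrite ?sqrrN expr1n.
have ec : e * `|c| = - c.
  rewrite /e; case: ifPn => [c0|]; first by rewrite ger0_norm// mulN1r.
  by rewrite -ltNge => c0; rewrite ltr0_norm// mul1r.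
pose w1 := Num.sqrt ((a - l) / D); pose w0 := e * Num.sqrt ((d - l) / D).
have w12 : w1 ^+ 2 = (a - l) / D by rewrite sqr_sqrtr// divr_ge0.
have w02 : w0 ^+ 2 = (d - l) / D.
  by rewrite exprMn e2 mul1r sqr_sqrtr ?divr_ge0.
have w01 : w0 * w1 = - c / D.
  rewrite /w0 /w1 -mulrA -sqrtrM ?divr_ge0// mulrACA [(d - l) * _]mulrC pr.
  rewrite -invfM -expr2 -exprVn -exprMn sqrtr_sqr normrM normfV (gtr0_norm Dp).
  by rewrite mulrA ec.
have al : a - l = D * w1 ^+ 2 by rewrite w12 mulrC divfK.
have dl : d - l = D * w0 ^+ 2 by rewrite w02 mulrC divfK.
have w1' : w0 ^+ 2 + w1 ^+ 2 = 1.
  by apply: (mulfI Dn0); rewrite mulrDr -al -dl; lra.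
have lw : l * (w0 ^+ 2 + w1 ^+ 2) = l by rewrite w1' mulr1.
rewrite -kl in al dl; exists w0, w1; split => //; clearbody w0 w1 k l; [lra|lra|].
by rewrite w01 -[l - k]opprB kl; clearbody D; field.
Qed.

Lemma ord2P (P : 'I_2 -> Prop) : P 0 -> P 1 -> forall i, P i.
Proof.
by move=> P0 P1; case=> -[|[|//]] i2; [move: P0|move: P1]; congr P; exact: val_inj.
Qed.

Lemma mulmxE2 (A : 'M[R]_2) v i : (A *m v) i 0 = A i 0 * v 0 0 + A i 1 * v 1 0.
Proof.
rewrite mxE !big_ord_recl big_ord0 addr0.
by congr (_ * _ + _ * _); congr (_ _ _); exact: val_inj.
Qed.

Lemma enormE v : enorm v = Num.sqrt (v 0 0 ^+ 2 + v 1 0 ^+ 2).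
Proof.
rewrite /enorm !big_ord_recl big_ord0 addr0; congr (Num.sqrt (_ + _ ^+ 2)).
by congr (v _ _); exact: val_inj.
Qed.

Lemma sqr_enorm v : enorm v ^+ 2 = v 0 0 ^+ 2 + v 1 0 ^+ 2.
Proof. by rewrite enormE sqr_sqrtr// addr_ge0// sqr_ge0. Qed.

Lemma enorm_ge0 v : 0 <= enorm v. Proof. exact: sqrtr_ge0. Qed.

Lemma enorm_eq0 v : (enorm v == 0) = (v == 0).
Proof.
rewrite -sqrf_eq0 sqr_enorm paddr_eq0 ?sqr_ge0// !sqrf_eq0.
apply/andP/eqP => [[/eqP v0 /eqP v1]|->]; last by rewrite !mxE.
apply/matrixP => i j; rewrite [j]ord1 !mxE.
by move: i; apply: ord2P.
Qed.

Lemma enorm_gt0 v : v != 0 -> 0 < enorm v.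
Proof. by rewrite lt0r enorm_eq0 enorm_ge0 andbT. Qed.

Definition dotp u v : R := u 0 0 * v 0 0 + u 1 0 * v 1 0.

Lemma wedge_dotp u v : wedge u v ^+ 2 + dotp u v ^+ 2 = (enorm u * enorm v) ^+ 2.
Proof. by rewrite exprMn !sqr_enorm /wedge /dotp; ring. Qed.

Lemma wedge_le u v : `|wedge u v| <= enorm u * enorm v.
Proof.
rewrite -ler_sqr ?nnegrE ?mulr_ge0 ?enorm_ge0// real_normK ?num_real//.
by rewrite -wedge_dotp lerDl sqr_ge0.
Qed.

Lemma det2 (A : 'M[R]_2) : \det A = A 0 0 * A 1 1 - A 0 1 * A 1 0.
Proof.
rewrite (expand_det_row _ 0) !big_ord_recl big_ord0 addr0 /cofactor !det_mx11 !mxE /=.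
rewrite expr0 expr1 mul1r mulN1r mulrN.
by congr (_ * A _ _ - A _ _ * A _ _); exact: val_inj.
Qed.

Lemma SL2_det g : val g 0 0 * val g 1 1 - val g 0 1 * val g 1 0 = 1.
Proof. by rewrite -det2 det_SL2. Qed.

Lemma SL2_singular g : exists k w, [/\ 1 <= k, enorm w = 1 &
  forall v, enorm (val g *m v) ^+ 2 =
    k ^+ 2 * wedge v w ^+ 2 + k ^- 2 * dotp v w ^+ 2].
Proof.
set p := val g 0 0; set q := val g 0 1; set r := val g 1 0; set s := val g 1 1.
have dg : p * s - q * r = 1 by exact: SL2_det.
have [|||K [w0 [w1 [K1 w1' aE dE cE]]]] :=
    @symmetric_spectral (p ^+ 2 + r ^+ 2) (p * q + r * s) (q ^+ 2 + s ^+ 2).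
- by rewrite addr_ge0// sqr_ge0.
- by rewrite addr_ge0// sqr_ge0.
- by rewrite -(expr1n _ 2) -dg; ring.
have K0 : 0 <= K by lra.
exists (Num.sqrt K), (\col_i (if i == 0 then w0 else w1)); split.
- by rewrite -sqrtr1 ler_sqrt.
- by rewrite enormE !mxE/= w1' sqrtr1.
move=> v; rewrite sqr_enorm !mulmxE2 -/p -/q -/r -/s sqr_sqrtr//.
rewrite /wedge /dotp !mxE/=.
transitivity ((p ^+ 2 + r ^+ 2) * v 0 0 ^+ 2 + (q ^+ 2 + s ^+ 2) * v 1 0 ^+ 2 +
  2 * (p * q + r * s) * v 0 0 * v 1 0); first by ring.
by rewrite aE dE cE; move: K^-1 => k; ring.
Qed.

Lemma SL2_svd g : exists w, [/\ enorm w = 1, 1 <= spnorm (val g) &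
  forall v, enorm (val g *m v) ^+ 2 =
    spnorm (val g) ^+ 2 * wedge v w ^+ 2 + spnorm (val g) ^- 2 * dotp v w ^+ 2].
Proof.
have [k [w [k1 w1 gv]]] := SL2_singular g; exists w.
suff -> : spnorm (val g) = k by [].
have k0 : 0 < k by rewrite (lt_le_trans ltr01).
(* [w'] is [w] turned by a right angle; the norm [k] is attained there. *)
pose w' : 'cV[R]_2 := \col_i (if i == 0 then w 1 0 else - w 0 0).
have w2 := sqr_enorm w; rewrite w1 expr1n in w2.
have wd : wedge w' w = 1 by rewrite /wedge !mxE /= w2; ring.
have wt : dotp w' w = 0 by rewrite /dotp !mxE /=; ring.
have w'1 : enorm w' = 1.
  by rewrite enormE !mxE /= sqrrN addrC -w2 sqrtr1.
have gk : enorm (val g *m w') = k.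
  apply/eqP; rewrite -(eqrXn2 (ltn0Sn 1)) ?enorm_ge0 ?ltW// gv wd wt.
  by rewrite expr1n expr0n/= mulr1 mulr0 addr0.
have ubk : ubound [set enorm (val g *m v) | v in [set v | enorm v = 1]] k.
  move=> _ [v /= v1 <-]; rewrite -ler_sqr ?nnegrE ?enorm_ge0 ?(ltW k0)//.
  have vw := wedge_dotp v w; rewrite v1 w1 mulr1 expr1n in vw.
 rewrite gv -[leRHS]mulr1 -vw mulrDr lerD2l ler_wpM2r ?sqr_ge0//.
  by rewrite (@le_trans _ _ 1)// ?invf_le1 ?exprn_gt0// exprn_ege1.
apply/eqP; rewrite eq_le; apply/andP; split.
  by apply: ge_sup => //; exists k, w'.
by apply: ub_le_sup; [exists k|exists w'].
Qed.

Lemma spnorm_ge1 g : 1 <= spnorm (val g).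
Proof. by have [w []] := SL2_svd g. Qed.

Lemma spnorm_gt0 g : 0 < spnorm (val g).
Proof. exact: lt_le_trans ltr01 (spnorm_ge1 g). Qed.

Lemma spnorm_spectral g : spnorm (val g) ^+ 2 + spnorm (val g) ^- 2 =
  val g 0 0 ^+ 2 + val g 0 1 ^+ 2 + val g 1 0 ^+ 2 + val g 1 1 ^+ 2.
Proof.
have [w [w1 _ gv]] := SL2_svd g.
have w2 := sqr_enorm w; rewrite w1 expr1n in w2.
have := gv (delta_mx 0 0); have := gv (delta_mx 1 0).
rewrite !sqr_enorm !mulmxE2 /wedge /dotp !mxE /= !(mulr0,mulr1,mul0r,mul1r,addr0,add0r,subr0,sub0r).
move=> h1 h2.
transitivity ((spnorm (val g) ^+ 2 + spnorm (val g) ^- 2) * (w 0 0 ^+ 2 + w 1 0 ^+ 2)).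
  by rewrite -w2 mulr1.
by rewrite -addrA addrACA h1 h2; ring.
Qed.

(** Solves [spnorm_spectral] for the norm. The norm is defined as an uncountable supremum; its
    measurability is read off this formula in the entries. *)
Lemma spnormE g : spnorm (val g) =
  let T := val g 0 0 ^+ 2 + val g 0 1 ^+ 2 + val g 1 0 ^+ 2 + val g 1 1 ^+ 2 in
  Num.sqrt ((T + Num.sqrt (T ^+ 2 - 4)) / 2).
Proof.
rewrite /= -spnorm_spectral; set k := spnorm _.
have k0 : 0 < k by exact: spnorm_gt0.
have k1 : 1 <= k by exact: spnorm_ge1.
have -> : (k ^+ 2 + k ^- 2) ^+ 2 - 4 = (k ^+ 2 - k ^- 2) ^+ 2 by field; rewrite gt_eqF.
rewrite sqrtr_sqr ger0_norm; last first.
  rewrite subr_ge0 (@le_trans _ _ 1)// ?invf_le1 ?exprn_gt0// exprn_ege1//.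
have -> : (k ^+ 2 + k ^- 2 + (k ^+ 2 - k ^- 2)) / 2 = k ^+ 2 by field; rewrite gt_eqF.
by rewrite sqrtr_sqr ger0_norm// ltW.
Qed.

Lemma enorm_mul_le g v : enorm (val g *m v) <= spnorm (val g) * enorm v.
Proof.
have [w [w1 k1 gv]] := SL2_svd g.
rewrite -ler_sqr ?nnegrE ?mulr_ge0 ?enorm_ge0// ?(le_trans ler01)//.
have vw := wedge_dotp v w; rewrite w1 mulr1 in vw.
rewrite gv exprMn -vw mulrDr lerD2l ler_wpM2r ?sqr_ge0//.
by rewrite (@le_trans _ _ 1)// ?invf_le1 ?exprn_gt0 ?(lt_le_trans ltr01)// exprn_ege1.
Qed.

Lemma enorm_mul_ge g v : enorm v <= spnorm (val g) * enorm (val g *m v).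
Proof.
have [w [w1 k1 gv]] := SL2_svd g.
have k0 : 0 < spnorm (val g) by exact: spnorm_gt0.
rewrite -ler_sqr ?nnegrE ?mulr_ge0 ?enorm_ge0// ?(ltW k0)//.
have vw := wedge_dotp v w; rewrite w1 mulr1 in vw.
rewrite exprMn gv -vw mulrDr [X in _ <= X + _]mulrA [X in _ <= _ + X]mulrA mulfV ?expf_neq0 ?gt_eqF// mul1r lerD2r.
by rewrite ler_peMl ?sqr_ge0// -exprD exprn_ege1.
Qed.

Lemma SL2_mulmx_neq0 g v : v != 0 -> val g *m v != 0.
Proof.
move=> v0; apply/eqP => gv0; have := enorm_mul_ge g v.
have e0 : enorm (0 : 'cV[R]_2) = 0 by apply/eqP; rewrite enorm_eq0.
by rewrite gv0 e0 mulr0 leNgt enorm_gt0.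
Qed.

Lemma spnorm_le_mul g (c : R) :
  (forall v, enorm (val g *m v) <= c * enorm v) -> spnorm (val g) <= c.
Proof.
move=> gc; apply: ge_sup.
  by exists (enorm (val g *m delta_mx 0 0)), (delta_mx 0 0) => //=; rewrite enormE !mxE /= expr1n expr0n addr0 sqrtr1.
by move=> _ [v /= v1 <-]; have := gc v; rewrite v1 mulr1.
Qed.

Lemma spnorm_SL2_mul g h : spnorm (val (SL2_mul g h)) <= spnorm (val g) * spnorm (val h).
Proof.
apply: spnorm_le_mul => v /=; rewrite -mulmxA (le_trans (enorm_mul_le _ _))//.
by rewrite -mulrA ler_wpM2l ?(ltW (spnorm_gt0 _))// enorm_mul_le.
Qed.

Lemma spnorm_SL2_mul_ge g h : spnorm (val h) <= spnorm (val g) * spnorm (val (SL2_mul g h)).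
Proof.
apply: spnorm_le_mul => v /=; rewrite (le_trans (enorm_mul_ge g _))//.
by rewrite mulmxA -mulrA ler_wpM2l ?(ltW (spnorm_gt0 _))// (enorm_mul_le (SL2_mul g h)).
Qed.

Lemma spnorm1 : spnorm (val (SL2_one R)) = 1.
Proof.
apply/eqP; rewrite eq_le spnorm_ge1 andbT; apply: spnorm_le_mul => v /=.
by rewrite mul1mx mul1r.
Qed.

Lemma dP_ge0 x y : 0 <= dP x y.
Proof. by rewrite /dP mulr_ge0// invr_ge0 mulr_ge0 ?enorm_ge0. Qed.

Lemma RP1_gen x : exists2 v, v != 0 & val x = <[v]>%VS.
Proof.
have v0 : vpick (val x) != 0.
  by rewrite vpick0; apply/eqP => x0; have := valP x; rewrite x0 dimv0.
exists (vpick (val x)) => //; apply/esym/eqP; rewrite eqEdim -memvE memv_pick /=.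
by rewrite (eqP (valP x)) dim_vline v0.
Qed.

Lemma RP1_line v : v != 0 -> exists x : RP1 R, val x = <[v]>%VS.
Proof.
move=> v0; have dv : \dim <[v]>%VS == 1%N by rewrite dim_vline v0.
by exists (exist (fun U : {vspace 'cV[R]_2} => \dim U == 1%N) <[v]>%VS dv).
Qed.

Lemma dP_le1 x y : dP x y <= 1.
Proof.
have [[u u0 xu] [v v0 yv]] := (RP1_gen x, RP1_gen y).
rewrite (dPE xu yv) ler_pdivrMr ?mulr_gt0 ?enorm_gt0// mul1r; exact: wedge_le.
Qed.

Lemma dPxx x : dP x x = 0.
Proof.
have [u u0 xu] := RP1_gen x.
have uu : wedge u u = 0 by rewrite /wedge; ring.
by rewrite (dPE xu xu) uu normr0 mul0r.
Qed.

Lemma dotp_le u v : `|dotp u v| <= enorm u * enorm v.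
Proof.
rewrite -ler_sqr ?nnegrE ?mulr_ge0 ?enorm_ge0// real_normK ?num_real//.
by rewrite -wedge_dotp lerDr sqr_ge0.
Qed.

(** After normalisation [wedge] and [dotp] are the sine and cosine of an angle, and [id] below is
    the addition formula for the sine. *)
Lemma dP_triangle y x z : dP x z <= dP x y + dP y z.
Proof.
have [[[u u0 xu] [v v0 yv]] [w w0 zw]] := (RP1_gen x, RP1_gen y, RP1_gen z).
rewrite (dPE xu yv) (dPE yv zw) (dPE xu zw).
have [[eu ev] ew] := (enorm_gt0 _ u0, enorm_gt0 _ v0, enorm_gt0 _ w0).
have id : wedge u w * enorm v ^+ 2 = wedge u v * dotp v w + dotp u v * wedge v w.
  by rewrite sqr_enorm /wedge /dotp; ring.
rewrite ler_pdivrMr ?mulr_gt0// -(ler_pM2r (exprn_gt0 2 ev)).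
have -> : `|wedge u w| * enorm v ^+ 2 = `|wedge u w * enorm v ^+ 2|.
  by rewrite normrM (ger0_norm (sqr_ge0 (enorm v))).
rewrite id (le_trans (ler_normD _ _))// !normrM.
have -> : (`|wedge u v| / (enorm u * enorm v) + `|wedge v w| / (enorm v * enorm w)) *
    (enorm u * enorm w) * enorm v ^+ 2 =
    `|wedge u v| * (enorm v * enorm w) + (enorm u * enorm v) * `|wedge v w|.
  by field; rewrite !gt_eqF.
by rewrite lerD// ?ler_wpM2l ?ler_wpM2r ?normr_ge0 ?dotp_le.
Qed.

Section omega.
Variable omega : SL2 R -> RP1 R.
Hypothesis omegaP : is_omega_minus omega.

(** [is_omega_minus] speaks of factorisations [K D L], so one is produced from the quadratic form:
    [L] has rows [w'] and [w], and [K] is solved for. *)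
Lemma omega_svd g w : 1 < spnorm (val g) -> enorm w = 1 ->
  (forall v, enorm (val g *m v) ^+ 2 =
    spnorm (val g) ^+ 2 * wedge v w ^+ 2 + spnorm (val g) ^- 2 * dotp v w ^+ 2) ->
  val (omega g) = <[w]>%VS.
Proof.
set k := spnorm _ => k1 w1 gv; have k0 : 0 < k by rewrite (lt_trans ltr01).
have w2 := sqr_enorm w; rewrite w1 expr1n in w2.
pose w' : 'cV[R]_2 := \col_i (if i == 0 then w 1 0 else - w 0 0).
pose L : 'M[R]_2 := \matrix_(i, j) (if i == 0 then w' j 0 else w j 0).
have eqM2 (A B : 'M[R]_2) : A 0 0 = B 0 0 -> A 0 1 = B 0 1 -> A 1 0 = B 1 0 ->
    A 1 1 = B 1 1 -> A = B.
  move=> h00 h01 h10 h11; apply/matrixP; apply: ord2P; apply: ord2P => //.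
have mulE (A B : 'M[R]_2) i j : (A *m B) i j = A i 0 * B 0 j + A i 1 * B 1 j.
  rewrite mxE !big_ord_recl big_ord0 addr0.
  by congr (_ * _ + A _ _ * B _ _); exact: val_inj.
have LL : L *m L^T = 1%:M.
  apply: eqM2; rewrite mulE !mxE/= ?mulr1n ?mulr0n; try ring.
  - by rewrite w2; ring.
  - by rewrite w2; ring.
have LL' : L^T *m L = 1%:M by exact: mulmx1C.
have Lu : L \in unitmx by case/mulmx1_unit: LL.
have iL : invmx L = L^T by rewrite -[LHS]mulmx1 -LL mulmxA mulVmx// mul1mx.
pose K := val g *m L^T *m diag2 k^-1 k.
have DE (a b : R) i j : diag2 a b i j = if i == j then if j == 0 then a else b else 0.
  by rewrite /diag2 !mxE; case: (eqVneq i j) => [->|_]; rewrite ?mulr1n ?mulr0n.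
have DD : diag2 k^-1 k *m diag2 k k^-1 = 1%:M.
  by apply: eqM2; rewrite mulE !DE !mxE/= ?mulr0 ?mul0r ?addr0 ?add0r ?mulVf ?mulfV ?gt_eqF.
rewrite (omegaP.1 g K L k k1 _ LL k1).
- congr <[_]>%VS; rewrite iL; apply/matrixP => i j; rewrite [j]ord1 mulmxE2.
  by move: i; apply: ord2P; rewrite !mxE/= ?mulr1n ?mulr0n; ring.
- rewrite /orthogonal_mx; apply: mulmx1C.
  (* The columns of [K] are [k^-1 g w'] and [k g w]. The form at [w'] and [w] gives their lengths;
     its value at [w' + w] gives their orthogonality by polarisation. *)
  have gw' := gv w'; have gw := gv w; have gww := gv (w' + w).
  have wd : wedge w' w = 1 by rewrite /wedge !mxE /= w2; ring.
  have wt : dotp w' w = 0 by rewrite /dotp !mxE /=; ring.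
  have wd' : wedge w w = 0 by rewrite /wedge; ring.
  have wt' : dotp w w = 1 by rewrite /dotp w2; ring.
  have wd2 : wedge (w' + w) w = 1 by rewrite -[RHS]addr0 -wd -wd' /wedge !mxE/=; ring.
  have wt2 : dotp (w' + w) w = 1 by rewrite -[RHS]add0r -wt -wt' /dotp !mxE/=; ring.
  rewrite wd2 wt2 mulmxDr sqr_enorm in gww.
  rewrite wd wt sqr_enorm in gw'; rewrite wd' wt' sqr_enorm in gw.
  have KE0 i : K i 0 = k^-1 * (val g *m w') i 0.
    by rewrite mulE mulE mulE !DE/= mulmxE2 !mxE/=; ring.
  have KE1 i : K i 1 = k * (val g *m w) i 0.
    by rewrite mulE mulE mulE !DE/= mulmxE2 !mxE/=; ring.
  move: gw' gw gww KE0 KE1.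
  move: (val g *m w') (val g *m w) => p q.
  rewrite !mxE expr1n expr0n/= !mulr1 !mulr0 add0r addr0 => gw' gw gww KE0 KE1.
  have pq : p 0 0 * q 0 0 + p 1 0 * q 1 0 = 0 by lra.
  clearbody K; apply: eqM2; rewrite mulE !mxE/= ?KE0 ?KE1 ?mulr1n ?mulr0n.
  - transitivity (k ^- 2 * (p 0 0 ^+ 2 + p 1 0 ^+ 2)); first by field; rewrite gt_eqF.
    by rewrite gw'; field; rewrite gt_eqF.
  - by rewrite -pq; field; rewrite gt_eqF.
  - by rewrite -pq; field; rewrite gt_eqF.
  - transitivity (k ^+ 2 * (q 0 0 ^+ 2 + q 1 0 ^+ 2)); first by ring.
    by rewrite gw; field; rewrite gt_eqF.
- by rewrite /K -[_ *m diag2 k k^-1]mulmxA DD mulmx1 -mulmxA LL' mulmx1.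
Qed.

(** The two summands of the singular value formula, with [|wedge v w| = |v| dP x (omega g)]. At
    [|g| = 1] the line [omega g] is arbitrary, but then [g] is an isometry and [dP <= 1]
    suffices. *)
Lemma omega_bounds g x v : v != 0 -> val x = <[v]>%VS ->
  spnorm (val g) * dP x (omega g) <= enorm (val g *m v) / enorm v <=
  spnorm (val g) * dP x (omega g) + (spnorm (val g))^-1.
Proof.
move=> v0 xv; have ev := enorm_gt0 _ v0.
have [w [w1 k1 gv]] := SL2_svd g; have k0 := spnorm_gt0 g.
have [k_gt1|k_le1] := ltP 1 (spnorm (val g)).
  have ow := omega_svd _ _ k_gt1 w1 gv.
  rewrite (dPE xv ow) w1 mulr1; set k := spnorm _ in k0 gv *.
  rewrite mulrA ler_pM2r ?invr_gt0// ler_pdivrMr// mulrDl divfK ?gt_eqF//.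
  apply/andP; split.
    rewrite -ler_sqr ?nnegrE ?enorm_ge0 ?mulr_ge0 ?(ltW k0)// gv exprMn.
    by rewrite real_normK ?num_real// lerDl mulr_ge0 ?sqr_ge0// invr_ge0 sqr_ge0.
  have kv0 : 0 <= k^-1 * enorm v by rewrite mulr_ge0 ?enorm_ge0 ?invr_ge0 ?(ltW k0).
  have kw0 : 0 <= k * `|wedge v w| by rewrite mulr_ge0 ?(ltW k0).
  rewrite -ler_sqr ?nnegrE ?enorm_ge0 ?addr_ge0// gv [leRHS]sqrrD [(k * `|_|) ^+ 2]exprMn.
  rewrite real_normK ?num_real// -addrA lerD2l -[leLHS]add0r lerD//.
    by rewrite mulrn_wge0// mulr_ge0.
  rewrite exprMn exprVn ler_wpM2l ?invr_ge0 ?sqr_ge0//.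
  have := wedge_dotp v w; rewrite w1 mulr1 => <-; by rewrite lerDr sqr_ge0.
have kE : spnorm (val g) = 1 by apply/eqP; rewrite eq_le k_le1.
have gvE : enorm (val g *m v) = enorm v.
  apply/eqP; rewrite -(eqrXn2 (ltn0Sn 1)) ?enorm_ge0// gv kE expr1n invr1 !mul1r.
  by rewrite wedge_dotp w1 mulr1.
by rewrite kE gvE divff ?gt_eqF// mul1r dP_le1 invr1 lerDr dP_ge0.
Qed.

End omega.
End linear_algebra.

(** * Logarithms of norms, and the motion of the contracted line along a product *)

Section log_norms.
Local Open Scope classical_set_scope.
Local Open Scope ring_scope.
Context {R : realType}.
Implicit Types (g h : SL2 R) (v : 'cV[R]_2) (x : RP1 R).

Definition lnorm g : R := ln (spnorm (val g)).

Definition lcocycle g v : R := ln (enorm (val g *m v) / enorm v).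

Lemma expR_lnorm g : expR (lnorm g) = spnorm (val g).
Proof. by rewrite lnK// posrE spnorm_gt0. Qed.

Lemma expR_lcocycle g v : v != 0 ->
  expR (lcocycle g v) = enorm (val g *m v) / enorm v.
Proof.
by move=> v0; rewrite lnK// posrE divr_gt0 ?enorm_gt0// SL2_mulmx_neq0.
Qed.

Lemma lnorm_ge0 g : 0 <= lnorm g.
Proof. by rewrite ln_ge0 ?spnorm_ge1. Qed.

Lemma lnorm1 : lnorm (SL2_one R) = 0.
Proof. by rewrite /lnorm spnorm1 ln1. Qed.

Lemma lnorm_mul g h : lnorm (SL2_mul g h) <= lnorm g + lnorm h.
Proof. by rewrite -ler_expR expRD !expR_lnorm spnorm_SL2_mul. Qed.

Lemma lnorm_mul_ge g h : lnorm h <= lnorm g + lnorm (SL2_mul g h).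
Proof. by rewrite -ler_expR expRD !expR_lnorm spnorm_SL2_mul_ge. Qed.

Lemma lcocycle_mul g h v : v != 0 ->
  lcocycle (SL2_mul g h) v = lcocycle g (val h *m v) + lcocycle h v.
Proof.
move=> v0; have hv0 := SL2_mulmx_neq0 h _ v0.
apply: expR_inj; rewrite expRD !expR_lcocycle//= mulmxA.
by rewrite mulrA divfK// enorm_eq0.
Qed.

Lemma lcocycle_le g v : v != 0 -> lcocycle g v <= lnorm g.
Proof.
move=> v0; rewrite -ler_expR expR_lnorm expR_lcocycle// ler_pdivrMr ?enorm_gt0//.
exact: enorm_mul_le.
Qed.

Lemma lcocycle_ge g v : v != 0 -> - lnorm g <= lcocycle g v.
Proof.
move=> v0; rewrite -ler_expR expRN expR_lnorm expR_lcocycle//.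
rewrite ler_pdivlMr ?enorm_gt0// ler_pdivrMl ?spnorm_gt0//.
exact: enorm_mul_ge.
Qed.

Lemma measurable_sqrt : measurable_fun [set: R] (@Num.sqrt R).
Proof. by apply: continuous_measurable_fun; exact: sqrt_continuous. Qed.

Lemma measurable_lnorm : measurable_fun setT lnorm.
Proof.
apply: (measurableT_comp (@measurable_ln R)).
under eq_fun do rewrite spnormE /=.
have mT : measurable_fun setT (fun g : SL2 R => val g 0 0 ^+ 2 + val g 0 1 ^+ 2 +
    val g 1 0 ^+ 2 + val g 1 1 ^+ 2).
  by repeat apply: measurable_funD; apply: measurable_funX; exact: measurable_SL2_entry.
apply: (measurableT_comp measurable_sqrt).
apply: measurable_funM => //; apply: measurable_funD => //.
apply: (measurableT_comp measurable_sqrt).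
by apply: measurable_funB => //; exact: measurable_funX.
Qed.

Lemma measurable_lcocycle v : measurable_fun setT (lcocycle ^~ v).
Proof.
apply: (measurableT_comp (@measurable_ln R)).
apply: measurable_funM => //.
under eq_fun do rewrite enormE !mulmxE2.
apply: (measurableT_comp measurable_sqrt).
by apply: measurable_funD; apply: measurable_funX; apply: measurable_funD;
  apply: measurable_funM => //; exact: measurable_SL2_entry.
Qed.

Section omega.
Variable omega : SL2 R -> RP1 R.
Hypothesis omegaP : is_omega_minus omega.

Lemma measurable_dP_omega x : measurable_fun setT (fun g => dP x (omega g)).
Proof.
apply: (measurability _ (RGenInftyO.measurableE R)).
move=> _ [_ [a ->] <-]; rewrite setTI.
apply: (omegaP.2 [set y | dP x y < a]) => y /= ya.
exists (a - dP x y); first by rewrite subr_gt0.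
move=> z yz; apply: le_lt_trans (dP_triangle y x z) _.
by rewrite -ltrBrDl.
Qed.

Lemma dP_omega_le g x v : v != 0 -> val x = <[v]>%VS ->
  dP x (omega g) <= expR (lcocycle g v - lnorm g).
Proof.
move=> v0 xv; have /andP[+ _] := omega_bounds _ omegaP g x v v0 xv.
rewrite expRD expRN expR_lnorm expR_lcocycle// => h.
by rewrite ler_pdivlMr ?spnorm_gt0// mulrC.
Qed.

Lemma lcocycle_omega_le g x v : v != 0 -> val x = <[v]>%VS ->
  expR (lcocycle g v) <= expR (lnorm g) * dP x (omega g) + expR (- lnorm g).
Proof.
move=> v0 xv; have /andP[_] := omega_bounds _ omegaP g x v v0 xv.
by rewrite expRN expR_lnorm expR_lcocycle.
Qed.

(** On [x = omega (gh)] the product expands by at most [|gh|^-1], so [h] expands [x] by at most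
    [|g| |gh|^-1 <= |g|^2 |h|^-1]; a line on which [h] is this small is close to [omega h]. *)
Lemma dP_omega_mul (b : R) g h : lnorm g <= b ->
  dP (omega (SL2_mul g h)) (omega h) <= expR (2 * b - 2 * lnorm h).
Proof.
move=> gb; set x := omega _; have [v v0 xv] := RP1_gen x.
apply: le_trans (dP_omega_le h x v v0 xv) _; rewrite ler_expR.
have := lcocycle_omega_le (SL2_mul g h) x v v0 xv.
rewrite dPxx mulr0 add0r ler_expR lcocycle_mul// => h1.
have := lcocycle_ge g (val h *m v) (SL2_mulmx_neq0 h _ v0).
have := lnorm_mul_ge g h; lra.
Qed.

(* The witness is the last time [m] at which [|a_m|^2 <= |a_n| / |a_n x|]:
   after it the contracted directions move by at most [e^(2b) |a_m|^(-2)] at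
   each step. *)
Lemma last_time (a : nat -> SL2 R) n (b : R) x v : 0 <= b -> a 0%N = SL2_one R ->
  (forall j, (j < n)%N -> exists2 g, lnorm g <= b & a j.+1 = SL2_mul g (a j)) ->
  v != 0 -> val x = <[v]>%VS ->
  exists m, [/\ (m <= n)%N, lnorm (a m) <= b * m%:R,
    lnorm (a n) - lcocycle (a n) v <= 2 * b + 2 * lnorm (a m) &
    dP x (omega (a m)) <= (n%:R * expR (2 * b) + 1) * expR (- 2 * lnorm (a m))].
Proof.
move=> b0 a0 aS v0 xv; set rho := _ - _.
have rho0 : 0 <= rho by rewrite subr_ge0 lcocycle_le.
have rho2 : rho <= 2 * lnorm (a n) by have := lcocycle_ge (a n) v v0; rewrite /rho; lra.
pose P m := (m <= n)%N && (2 * lnorm (a m) <= rho).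
have exP : exists m, P m by exists 0%N; rewrite /P leq0n/= a0 lnorm1 mulr0.
have Pn m : P m -> (m <= n)%N by case/andP.
have [m /andP[mn am] mmax] := ex_maxnP exP Pn.
have after j : (m < j)%N -> (j <= n)%N -> rho < 2 * lnorm (a j).
  by move=> mj jn; rewrite ltNge; apply/negP => h; have := mmax j; rewrite /P jn h leqNgt mj => /(_ isT).
(* [rho] separates [2 * lnorm (a m)] from the later [2 * lnorm (a j)], so the norm never falls below
   [|a_m|] again before time [n]. *)
have amj j : (m <= j)%N -> (j <= n)%N -> lnorm (a m) <= lnorm (a j).
  rewrite leq_eqVlt => /predU1P[->//|mj] jn; have := after j mj jn; lra.
exists m; split=> //.
- have : forall j, (j <= n)%N -> lnorm (a j) <= b * j%:R.
    elim=> [|j IH] jn; first by rewrite a0 lnorm1 mulr0.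
    have [g gb ->] := aS j jn; rewrite -natr1 mulrDr mulr1.
    by have := lnorm_mul g (a j); have := IH (ltnW jn); lra.
  exact.
- have [mn'|] := ltnP m n; last first.
    by move=> nm; have -> : m = n; [apply/eqP; rewrite eqn_leq mn|lra].
  have := after m.+1 (ltnSn m) mn'; have [g gb ->] := aS m mn'.
  have := lnorm_mul g (a m); lra.
(* Induction backwards from time [n], where the distance is at most [e^(- rho) <= |a_m|^(-2)]; each
   step back adds at most [e^(2b) |a_m|^(-2)]. *)
- have chain i : (i <= n - m)%N -> dP x (omega (a (n - i)%N)) <=
      (i%:R * expR (2 * b) + 1) * expR (- 2 * lnorm (a m)).
    elim: i => [_|i IH im].
      rewrite subn0 mul0r add0r mul1r (le_trans (dP_omega_le _ x v v0 xv))//.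
      by rewrite ler_expR; rewrite /rho in am; lra.
    have ni : (n - i)%N = (n - i.+1).+1.
      by rewrite subnSK//; apply: leq_trans im (leq_subr _ _).
    have jn : (n - i.+1 < n)%N by rewrite -ni leq_subr.
    have mj : (m <= n - i.+1)%N.
      by rewrite leq_subRL ?(leq_trans im (leq_subr _ _))// addnC -leq_subRL.
    apply: le_trans (dP_triangle (omega (a (n - i)%N)) _ _) _.
    have := IH (ltnW im); set d1 := dP x _; set d2 := dP _ _ => hd1.
    have hd2 : d2 <= expR (2 * b - 2 * lnorm (a m)).
      rewrite /d2 ni; have [g gb ->] := aS _ jn.
      apply: le_trans (dP_omega_mul b _ _ gb) _; rewrite ler_expR.
      by have := amj _ mj (ltnW jn); lra.
    apply: le_trans (lerD hd1 hd2) _.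
    by rewrite expRD mulNr -[i.+1%:R]natr1 le_eqVlt; apply/orP; left; apply/eqP; ring.
  have := chain (n - m)%N (leqnn _); rewrite subKn// => /le_trans; apply.
  rewrite ler_wpM2r ?expR_ge0// lerD2r ler_wpM2r ?expR_ge0// ler_nat.
  exact: leq_subr.
Qed.

End omega.
End log_norms.

(** * The complement of the support is null, and a compact support bounds the norms *)

Section support.
Local Open Scope classical_set_scope.
Local Open Scope ring_scope.
Context {R : realType}.

Lemma measurable_set_le d (T : measurableType d) (f g : T -> R) :
  measurable_fun setT f -> measurable_fun setT g -> measurable [set x | f x <= g x].
Proof.
move=> mf mg; have := measurable_fun_ler mf mg measurableT (Y := [set true]) I.
by rewrite setTI.
Qed.

Lemma measurable_set_lt d (T : measurableType d) (f g : T -> R) :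
  measurable_fun setT f -> measurable_fun setT g -> measurable [set x | f x < g x].
Proof.
move=> mf mg; have := measurable_fun_ltr mf mg measurableT (Y := [set true]) I.
by rewrite setTI.
Qed.

Lemma rational_box (V : set 'M[R]_2) (M : 'M[R]_2) : open V -> V M ->
  exists q : 'M[rat]_2 * nat,
    let box := [set N : 'M[R]_2 | forall i j, `|ratr (q.1 i j) - N i j| < q.2.+1%:R^-1] in
    box M /\ box `<=` V.
Proof.
move=> oV VM.
have /nbhs_ballP[e /= e0 eV] : nbhs M V by exact: open_nbhs_nbhs.
have [n /= ne] : exists n, n.+1%:R^-1 < e / 2 :> R.
  have e20 : 0 < e / 2 by rewrite divr_gt0.
  have [n _ /(_ n (leqnn n))] := near_infty_natSinv_lt (PosNum e20).
  by exists n.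
have q_ i j : exists q : rat, `|ratr q - M i j| < n.+1%:R^-1.
  have : M i j < M i j + n.+1%:R^-1 by rewrite ltrDl invr_gt0.
  move=> /rat_in_itvoo[r]; rewrite in_itv /= => /andP[r1 r2]; exists r.
  by rewrite ger0_norm ?subr_ge0 ?(ltW r1)// ltrBlDl.
exists (\matrix_(i < 2, j < 2) projT1 (cid (q_ i j)), n); split=> [i j|N /= qN].
  by rewrite /= mxE; case: cid.
apply: eV; split => // i j; rewrite /ball /=.
have := qN i j; rewrite mxE; case: cid => r /= rM rN.
apply: (le_lt_trans (ler_distD (ratr r) _ _)).
rewrite (splitr e) ltrD//; first by rewrite distrC (lt_trans rM).
exact: lt_trans rN _.
Qed.

(** Each point outside the support has a null neighbourhood, hence lies in a null rational box, and
    there are only countably many boxes. *)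
Lemma open_disjoint_supp (mu : probability (SL2 R) R) (N : set (SL2 R)) :
  open N -> N `&` supp_mu mu = set0 -> mu N = 0%E.
Proof.
move=> oN Nsupp.
have mN : measurable N by exact: SL2_open_measurable.
pose box (q : 'M[rat]_2 * nat) : set (SL2 R) :=
  [set g : SL2 R | forall i j, `|ratr (q.1 i j) - val g i j| < q.2.+1%:R^-1].
have mbox q : measurable (box q).
  have -> : box q = \bigcap_(ij in [set: 'I_2 * 'I_2])
      (fun g : SL2 R => val g ij.1 ij.2) @^-1` ball (ratr (q.1 ij.1 ij.2) : R) q.2.+1%:R^-1.
    apply/seteqP; split=> [x bx [i j] _|x bx i j]; first exact: bx.
    exact: (bx (i, j)).
  apply: fin_bigcap_measurable => [|[i j] _]; first exact: finite_finset.
  rewrite -[X in measurable X]setTI; apply: measurable_SL2_entry => //.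
  exact: measurable_ball.
pose F k := if unpickle k is Some q then
  if mu (box q) == 0%E then box q else set0 else set0.
have F0 k : mu.-negligible (F k).
  rewrite /F; case: unpickle => [q|]; last exact: negligible_set0.
  by case: eqP => [q0|_]; [exists (box q); split|exact: negligible_set0].
apply: measure_negligible => //.
apply: negligibleS (negligible_bigcup F0) => g Ng.
have : ~ supp_mu mu g.
  by move=> gs; have : (N `&` supp_mu mu) g by []; rewrite Nsupp.
rewrite /supp_mu /= => /existsNP[U] /not_implyP[oU] /not_implyP[Ug] /negP.
rewrite -leNgt => U0.
have [V oV VU] := oU.
have [|q [/= qg qV]] := @rational_box V (val g) oV; first by move: Ug; rewrite -VU.
exists (pickle q) => //; rewrite /F pickleK.
suff -> : mu (box q) = 0%E by rewrite eqxx.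
apply/eqP; rewrite eq_le measure_ge0 andbT (le_trans _ U0)//.
apply: le_measure; rewrite ?inE//; first exact: SL2_open_measurable.
by move=> h qh; rewrite -VU; apply: qV.
Qed.

Lemma lnorm_bounded (mu : probability (SL2 R) R) : compactly_supported mu ->
  exists2 b : R, 0 < b & mu [set g | b < lnorm g] = 0%E.
Proof.
move=> cmu; pose f (g : SL2 R) : 'M[R]_2 := val g.
have : compact (f @` supp_mu mu).
  apply: continuous_compact => //; apply: continuous_subspaceT.
  exact: SL2_val_continuous.
move=> /compact_bounded[M [_ /(_ (`|M| + 1))]].
rewrite (le_lt_trans (ler_norm _))// ?ltrDl// => /(_ isT) fM.
pose c : R := `|M| + 1; have c1 : 1 <= c by rewrite lerDr.
pose N := f @^-1` [set A | c < `|A|].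
have oN : open N.
  apply: open_comp; first by move=> g _; exact: SL2_val_continuous.
  have -> : [set A : 'M[R]_2 | c < `|A|] = (fun A : 'M[R]_2 => `|A|) @^-1` [set r | c < r] by [].
  apply: open_comp; last exact: open_gt.
  by move=> A _; exact: norm_continuous.
have N0 : mu N = 0%E.
  apply: open_disjoint_supp => //; apply/seteqP; split=> // g [/= Ng gs].
  have := fM (f g) (ex_intro2 _ _ g gs erefl); rewrite /globally/=. by rewrite leNgt Ng.
have c20 : 0 < 2 * c by lra.
(* The squared norm is at most the sum of the four squared entries, hence at most [4 c^2]. *)
exists (ln (2 * c)); first by rewrite ln_gt0//; lra.
have mB : measurable [set g | ln (2 * c) < @lnorm R g].
  by apply: measurable_set_lt => //; exact: measurable_lnorm.
apply/eqP; rewrite eq_le measure_ge0 andbT -N0.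
apply: le_measure; rewrite ?inE//; first exact: SL2_open_measurable.
move=> g /=; apply: contraTT; rewrite -!leNgt => gc.
rewrite ler_ln ?posrE ?spnorm_gt0//.
have k0 := spnorm_gt0 g.
rewrite -ler_sqr ?nnegrE ?(ltW k0) ?(ltW c20)//.
have ent i j : val g i j ^+ 2 <= c ^+ 2.
  have : `|val g i j| <= c.
    apply: le_trans gc; rewrite [leRHS]mx_normrE.
    exact: (@le_bigmax _ _ _ 0 (fun ij => `|val g ij.1 ij.2|) (i, j)).
  by rewrite -ler_sqr ?nnegrE ?normr_ge0 ?real_normK ?num_real//; lra.
have := ent 0 0; have := ent 0 1; have := ent 1 0; have := ent 1 1.
have := spnorm_spectral g.
have : 0 <= spnorm (val g) ^- 2 by rewrite invr_ge0 sqr_ge0.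
lra.
Qed.

End support.

(** * Random products realised on a finite product space *)

Section path_space.
Local Open Scope classical_set_scope.
Local Open Scope ereal_scope.
Context {R : realType}.
Variable mu : probability (SL2 R) R.

Lemma measurable_SL2_mul2 d (T : measurableType d) (f g : T -> SL2 R) :
  measurable_fun setT f -> measurable_fun setT g ->
  measurable_fun setT (fun x => SL2_mul (f x) (g x)).
Proof.
move=> mf mg.
exact: (measurableT_comp (@measurable_SL2_mul R) (measurable_fun_pair mf mg)).
Qed.

Lemma integral_conv0 (f : SL2 R -> \bar R) : measurable_fun setT f ->
  \int[convn mu 0]_g f g = f (SL2_one R).
Proof. by move=> mf; rewrite integral_dirac// diracT mul1e. Qed.

Lemma integral_convS n (f : SL2 R -> \bar R) : measurable_fun setT f ->
  (forall g, 0 <= f g) ->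
  \int[convn mu n.+1]_g f g = \int[mu]_g \int[convn mu n]_h f (SL2_mul g h).
Proof.
move=> mf f0; rewrite ge0_integral_distribution//.
rewrite (fubini_tonelli1 (fun z => f (SL2_mul z.1 z.2)))//.
by apply: (measurableT_comp mf); exact: measurable_SL2_mul.
Qed.

(** [T] carries [n] independent steps: [a m] is the product of the first [m], [c m] that of the
    others, and [N] collects the paths having a step of norm above [e^b]. Only the law of each
    single pair [(a m, c m)] is recorded, because the estimates are summed over [m] afterwards. *)
Lemma path_space (b : R) n : mu [set g | (b < lnorm g)%R] = 0 ->
  exists (d : measure_display) (T : measurableType d) (P : probability T R)
    (a c : nat -> T -> SL2 R) (N : set T),
  [/\ measurable N /\ P N = 0,
      forall m, (m <= n)%N -> measurable_fun setT (a m) /\ measurable_fun setT (c m),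
      forall m (f : SL2 R * SL2 R -> \bar R), (m <= n)%N -> measurable_fun setT f ->
        (forall z, 0 <= f z) ->
        \int[P]_w f (a m w, c m w) = \int[convn mu m]_g \int[convn mu (n - m)]_h f (g, h),
      forall w, a 0%N w = SL2_one R /\
        (forall m, (m <= n)%N -> SL2_mul (c m w) (a m w) = a n w) &
      forall w j, ~ N w -> (j < n)%N ->
        exists2 g, (lnorm g <= b)%R & a j.+1 w = SL2_mul g (a j w)].
Proof.
move=> mub; have SL2_mul1 (g : SL2 R) : SL2_mul (SL2_one R) g = g.
  by apply: val_inj; rewrite /= mul1mx.
have SL2_mulA (g h k : SL2 R) : SL2_mul (SL2_mul g h) k = SL2_mul g (SL2_mul h k).
  by apply: val_inj; rewrite /= mulmxA.
elim: n => [|n [d [T [P [a [c [N [[mN N0] mac law init step]]]]]]]].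
  exists _, (SL2 R), (convn mu 0), (fun _ _ => SL2_one R), (fun _ _ => SL2_one R), set0.
  split=> //.
  - move=> m f; rewrite leqn0 => /eqP -> mf f0; rewrite sub0n.
    rewrite [RHS]integral_conv0; last first.
      exact: (measurable_fun_fubini_tonelli_F (m2 := convn mu 0) f mf f0).
    by rewrite !integral_conv0//; exact: measurableT_comp.
(* The new step multiplies on the left, as in the recursion of [convn]: it extends every remainder
   [c m] with [m <= n], and turns [a n] into the full product, whose remainder is [1]. *)
exists _, (SL2 R * T)%type, (mu \x P : probability _ _),
  (fun m z => if (m <= n)%N then a m z.2 else SL2_mul z.1 (a n z.2)),
  (fun m z => if (m <= n)%N then SL2_mul z.1 (c m z.2) else SL2_one R),
  ([set g | (b < lnorm g)%R] `*` setT `|` setT `*` N).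
have mB : measurable [set g : SL2 R | (b < lnorm g)%R].
  by apply: measurable_set_lt => //; exact: measurable_lnorm.
have mA m : (m <= n)%N -> measurable_fun setT (fun z : SL2 R * T => a m z.2).
  by move=> mn; apply: (measurableT_comp (mac m mn).1).
have mC m : (m <= n)%N -> measurable_fun setT (fun z : SL2 R * T => SL2_mul z.1 (c m z.2)).
  move=> mn; apply: measurable_SL2_mul2 => //.
  by apply: (measurableT_comp (mac m mn).2).
have mAn : measurable_fun setT (fun z : SL2 R * T => SL2_mul z.1 (a n z.2)).
  by apply: measurable_SL2_mul2 => //; exact: mA.
split.
- split; first by apply: measurableU; exact: measurableX.
  apply/eqP; rewrite eq_le measure_ge0 andbT.
  apply: le_trans (measureU2 _ _ _) _; try exact: measurableX.
  have e1 : (mu \x P) ([set g | (b < lnorm g)%R] `*` setT) = 0.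
    rewrite [LHS](product_measure1E mu P mB measurableT) -[RHS](mul0e (P setT)).
    by congr (_ * _); exact: mub.
  have e2 : (mu \x P) (setT `*` N) = 0.
    rewrite [LHS](product_measure1E mu P measurableT mN) -[RHS](mule0 (mu setT)).
    by congr (_ * _); exact: N0.
  by rewrite -[leRHS]adde0; apply: leeD; rewrite le_eqVlt; apply/orP; left; apply/eqP.
- by move=> m _; case: (leqP m n) => mn; split => //; [exact: mA|exact: mC].
- move=> m f mn1 mf f0; case: (leqP m n) => mn.
    rewrite (fubini_tonelli1 (fun z => f (a m z.2, SL2_mul z.1 (c m z.2))))//; last first.
      apply: (measurableT_comp mf); apply: measurable_fun_pair; [exact: mA|exact: mC].
    rewrite /fubini_F /=.
    have mfg g : measurable_fun setT (fun z : SL2 R * SL2 R => f (z.1, SL2_mul g z.2)).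
      apply: (measurableT_comp mf); apply: measurable_fun_pair => //.
      exact: measurable_SL2_mul2.
    under eq_integral => g _ do rewrite (law m (fun z => f (z.1, SL2_mul g z.2)))//.
    rewrite (fubini_tonelli (fun z => \int[convn mu (n - m)]_h f (z.2, SL2_mul z.1 h)))//=.
    + rewrite subSn//; apply: eq_integral => y _.
      by rewrite integral_convS//; exact: measurableT_comp.
    + apply: (measurable_fun_fubini_tonelli_F (m2 := convn mu (n - m))
        (fun z : (SL2 R * SL2 R) * SL2 R => f (z.1.2, SL2_mul z.1.1 z.2))) => //.
      apply: (measurableT_comp mf); apply: measurable_fun_pair => //.
        exact: measurableT_comp.
      by apply: measurable_SL2_mul2 => //; exact: measurableT_comp.
    + by move=> z; exact: integral_ge0.
  have {mn mn1} -> : m = n.+1 by apply/eqP; rewrite eqn_leq mn1.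
  have mf1 : measurable_fun setT (fun g => f (g, SL2_one R)) by exact: measurableT_comp.
  rewrite (fubini_tonelli1 (fun z => f (SL2_mul z.1 (a n z.2), SL2_one R)))//; last first.
    by apply: (measurableT_comp mf1).
  rewrite /fubini_F /= subnn.
  under [RHS]eq_integral => g _.
    rewrite integral_conv0; last exact: measurableT_comp.
    over.
  rewrite integral_convS//; apply: eq_integral => g _.
  rewrite (law n (fun z => f (SL2_mul g z.1, SL2_one R)))//; last first.
    apply: (measurableT_comp mf1); exact: measurable_SL2_mul2.
  rewrite subnn; apply: eq_integral => y _.
  rewrite /= integral_conv0 //; exact: measurable_cst.
- move=> [g w]; have [i1 i3] := init w; split => //=.
  move=> m _; rewrite ltnn; case: ifPn => mn //=; first by rewrite SL2_mulA i3.
- move=> [g w] j /= Nw jn; rewrite (ltnS j n) in jn; rewrite jn.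
  case: ifPn => jn'; first by apply: step => // Nw'; apply: Nw; right.
  exists g; first by rewrite leNgt; apply/negP => bg; apply: Nw; left.
  by have -> : j = n by apply/eqP; rewrite eqn_leq jn leqNgt.
Qed.

(** [convn] adds one factor at a time on the left; the path space regroups the product at an
    arbitrary time. *)
Lemma integral_conv_split (b : R) m n (f : SL2 R -> \bar R) :
  mu [set g | (b < lnorm g)%R] = 0 -> (m <= n)%N ->
  measurable_fun setT f -> (forall g, 0 <= f g) ->
  \int[convn mu n]_g f g =
    \int[convn mu m]_g \int[convn mu (n - m)]_h f (SL2_mul h g).
Proof.
move=> mu0 mn mf f0.
have [d [T [P [a [c [N [_ mac law init _]]]]]]] := path_space b n mu0.
have mfc : measurable_fun setT (fun z : SL2 R * SL2 R => f (SL2_mul z.2 z.1)).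
  by apply: (measurableT_comp mf); exact: measurable_SL2_mul2.
rewrite -(law m (fun z => f (SL2_mul z.2 z.1)))//=.
transitivity (\int[P]_w f (a n w)).
  rewrite (law n (fun z => f z.1))//; last exact: measurableT_comp.
  rewrite subnn; apply: eq_integral => g _.
  by rewrite /= integral_conv0//; exact: measurable_cst.
by apply: eq_integral => w _; have [_ /(_ m mn) ->] := init w.
Qed.
End path_space.

(** * Integrated form of the splitting at the last time *)

Section decomposition.
Local Open Scope classical_set_scope.
Local Open Scope ereal_scope.
Context {R : realType}.
Variables (mu : probability (SL2 R) R) (b : R).
Hypothesis b0 : (0 < b)%R.
Hypothesis mub : mu [set g | (b < lnorm g)%R] = 0.

(** Reduces an estimate of integrals to a deterministic one along products with steps of norm at
    most [e^b]; the other paths form a null set. *)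
Lemma path_bound n (f : SL2 R -> \bar R) (F : nat -> SL2 R * SL2 R -> \bar R) :
  measurable_fun setT f -> (forall g, 0 <= f g) ->
  (forall m, measurable_fun setT (F m)) -> (forall m z, 0 <= F m z) ->
  (forall a c : nat -> SL2 R, a 0%N = SL2_one R ->
    (forall m, (m <= n)%N -> SL2_mul (c m) (a m) = a n) ->
    (forall j, (j < n)%N -> exists2 g, (lnorm g <= b)%R & a j.+1 = SL2_mul g (a j)) ->
    f (a n) <= \sum_(m < n.+1) F m (a m, c m)) ->
  \int[convn mu n]_g f g <=
    \sum_(m < n.+1) \int[convn mu m]_g \int[convn mu (n - m)]_h F m (g, h).
Proof.
move=> mf f0 mF F0 fF.
have [d [T [P [a [c [N [[mN N0] mac law init step]]]]]]] := path_space mu b n mub.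
have -> : \int[convn mu n]_g f g = \int[P]_w f (a n w).
  rewrite (law n (fun z => f z.1))//; last exact: measurableT_comp.
  rewrite subnn; apply: eq_integral => g _.
  by rewrite /= integral_conv0//; exact: measurable_cst.
have mFac m : (m <= n)%N -> measurable_fun setT (fun w => F m (a m w, c m w)).
  move=> mn; apply: (measurableT_comp (mF m)).
  by apply: measurable_fun_pair; have [] := mac m mn.
under eq_bigr => m _.
  rewrite -(law m (F m)) ?leq_ord//.
  over.
rewrite -(@ge0_integral_sum _ _ _ P setT measurableT _
  (fun (m : 'I_n.+1) w => F m (a m w, c m w)))//=; last first.
  by move=> m; apply: mFac; rewrite leq_ord.
apply: ae_ge0_le_integral => //.
- by apply: (measurableT_comp mf); have [] := mac n (leqnn n).
- by move=> w _; exact: sume_ge0.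
- by apply: emeasurable_sum => m; apply: mFac; rewrite leq_ord.
- exists N; split=> // w /= h; apply: contrapT => Nw; apply: h => _.
  have [i1 i3] := init w.
  by apply: (fF (fun m => a m w) (fun m => c m w)) => // j; exact: step.
Qed.

Lemma convn_lnorm n : convn mu n [set g | (b * n%:R < lnorm g)%R] = 0.
Proof.
set A := [set g | _]; have mA : measurable A.
  by apply: measurable_set_lt => //; exact: measurable_lnorm.
apply/eqP; rewrite eq_le measure_ge0 andbT.
rewrite -[A]setIT -integral_indic//.
apply: le_trans (@path_bound n _ (fun _ => cst 0) _ _ _ _ _) _ => //.
- by apply/measurable_EFinP; exact: measurable_indic.
- move=> a c a0 _ aS; rewrite big1// lee_fin indicE memNset//=.
  apply/negP; rewrite -leNgt.
  have : forall j, (j <= n)%N -> (lnorm (a j) <= b * j%:R)%R.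
    elim=> [|j IH] jn; first by rewrite a0 lnorm1 mulr0.
    have [g gb ->] := aS j jn; rewrite -natr1 mulrDr mulr1.
    by have := lnorm_mul g (a j); have := IH (ltnW jn); lra.
  exact.
- rewrite big1// => m _; under eq_integral do rewrite /= integral0.
  by rewrite integral0.
Qed.

Lemma le_integral_convn n (f h : SL2 R -> \bar R) :
  measurable_fun setT f -> measurable_fun setT h ->
  (forall g, 0 <= f g) -> (forall g, 0 <= h g) ->
  (forall g, (lnorm g <= b * n%:R)%R -> f g <= h g) ->
  \int[convn mu n]_g f g <= \int[convn mu n]_g h g.
Proof.
move=> mf mh f0 h0 fh; apply: ae_ge0_le_integral => //.
exists [set g | (b * n%:R < lnorm g)%R]; split.
- by apply: measurable_set_lt => //; exact: measurable_lnorm.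
- exact: convn_lnorm.
- by move=> g /= H; rewrite ltNge; apply/negP => gn; apply: H => _; exact: fh.
Qed.

Variable omega : SL2 R -> RP1 R.
Hypothesis omegaP : is_omega_minus omega.

(** What [last_time] says of [a m]: [n] is the full length, [m] the last time, and [r] a lower bound
    for [lnorm - lcocycle] of the full product. *)
Definition contracting (n m : nat) (r : R) (x : RP1 R) : set (SL2 R) :=
  [set a | [/\ lnorm a <= b * m%:R, r <= 2 * b + 2 * lnorm a &
    dP x (omega a) <= (n%:R * expR (2 * b) + 1) * expR (- 2 * lnorm a)]%R].

Lemma measurable_contracting n m r x : measurable (contracting n m r x).
Proof.
have mell := @measurable_lnorm R.
have -> : contracting n m r x = [set a | lnorm a <= b * m%:R]%R `&`
    ([set a | r <= 2 * b + 2 * lnorm a]%R `&`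
     [set a | dP x (omega a) <= (n%:R * expR (2 * b) + 1) * expR (- 2 * lnorm a)]%R).
  by apply/seteqP; split=> [a [? ? ?]|a [? [? ?]]].
apply: measurableI; [|apply: measurableI]; apply: measurable_set_le => //.
- by apply: measurable_funD => //; exact: measurable_funM.
- exact: measurable_dP_omega.
- apply: measurable_funM => //; apply: (measurableT_comp (@measurable_expR R)).
  exact: measurable_funM.
Qed.

Lemma measurable_expR_lcocycle (t : R) v :
  measurable_fun setT (fun g => expR (t * lcocycle g v)).
Proof.
apply: (measurableT_comp (@measurable_expR R)); apply: measurable_funM => //.
exact: measurable_lcocycle.
Qed.

Lemma measurable_expR_lnorm (t : R) :
  measurable_fun setT (fun g : SL2 R => expR (t * lnorm g)).
Proof.
apply: (measurableT_comp (@measurable_expR R)); apply: measurable_funM => //.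
exact: measurable_lnorm.
Qed.

(** The bound [U m] on the remaining factor is asked only where [contracting] is inhabited. The
    induction in [cocycle_bound] depends on this, as it rules out small [m]. *)
Lemma decomposition n (r t : R) x v (U : nat -> R) : (t <= 0)%R -> v != 0%R ->
  val x = <[v]>%VS -> (forall m, 0 <= U m)%R ->
  (forall m, (m <= n)%N -> contracting n m r x !=set0 -> forall u, u != 0%R ->
    \int[convn mu (n - m)]_g (expR (t * lcocycle g u))%:E <= (U m)%:E) ->
  \int[convn mu n]_g
    (\1_[set g | r <= lnorm g - lcocycle g v]%R g * expR (t * lcocycle g v))%:E <=
  \sum_(m < n.+1) (U m)%:E * \int[convn mu m]_g
    (\1_(contracting n m r x) g * expR (- t * lnorm g))%:E.
Proof.
move=> t0 v0 xv U0 HU.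
have mS : measurable [set g : SL2 R | r <= lnorm g - lcocycle g v]%R.
  apply: measurable_set_le => //; apply: measurable_funB.
    exact: measurable_lnorm.
  exact: measurable_lcocycle.
pose F m (z : SL2 R * SL2 R) : \bar R :=
  (\1_(contracting n m r x) z.1 * expR (t * lcocycle (SL2_mul z.2 z.1) v))%:E.
have mD m : measurable_fun setT (\1_(contracting n m r x) : SL2 R -> R)%R.
  by apply: measurable_indic; exact: measurable_contracting.
apply: le_trans (@path_bound n _ F _ _ _ _ _) _ => //.
- apply/measurable_EFinP; apply: measurable_funM; first exact: measurable_indic.
  exact: measurable_expR_lcocycle.
- move=> m; apply/measurable_EFinP; apply: measurable_funM.
    exact: measurableT_comp.
  apply: (measurableT_comp (measurable_expR_lcocycle t v)).
  exact: measurable_SL2_mul2.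
- by move=> m z; rewrite lee_fin mulr_ge0 ?expR_ge0.
- move=> a c a0 ac aS; rewrite /F.
  have [rS|rS] := boolP (a n \in [set g : SL2 R | r <= lnorm g - lcocycle g v]%R); last first.
    by rewrite indicE (negbTE rS) mul0r sume_ge0.
  have [m [mn mb mrho md]] := last_time omega omegaP a n b x v (ltW b0) a0 aS v0 xv.
  rewrite (bigD1 (Ordinal (mn : m < n.+1)%N))//= ac//.
  rewrite [in X in X <= _]indicE rS indicE mem_set.
    by rewrite leeDl// sume_ge0.
  by split=> //; move: rS; rewrite inE /=; lra.
- apply: lee_sum => -[m /= mn] _.
  have mEc (u : 'cV[R]_2) : measurable_fun setT (fun c => (expR (t * lcocycle c u))%:E).
    by apply/measurable_EFinP; exact: measurable_expR_lcocycle.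
  have mDe : measurable_fun setT (fun g => (\1_(contracting n m r x) g * expR (- t * lnorm g))%:E).
    by apply/measurable_EFinP; apply: measurable_funM => //; exact: measurable_expR_lnorm.
  rewrite -ge0_integralZl ?lee_fin//.
  apply: ge0_le_integral => //.
  - by move=> g _; apply: integral_ge0 => h _; rewrite lee_fin mulr_ge0 ?expR_ge0.
  - apply: (measurable_fun_fubini_tonelli_F (m2 := convn mu (n - m)) (F m)).
      apply/measurable_EFinP; apply: measurable_funM.
        exact: measurableT_comp.
      apply: (measurableT_comp (measurable_expR_lcocycle t v)).
      exact: measurable_SL2_mul2.
    by move=> z; rewrite lee_fin mulr_ge0 ?expR_ge0.
  - exact: measurable_funeM.
  - move=> a _; rewrite /F /=.
    rewrite indicE; have [aD|aD] := boolP (a \in contracting n m r x); last first.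
      under eq_integral do rewrite mul0r.
      by rewrite integral0 mul0r mule0.
    (* By the cocycle rule the remainder acts on the line of [a v] and is bounded by [U m] whatever
       that line is; [- lnorm a <= lcocycle a v] and [t <= 0] leave the weight [|a|^(-t)]. *)
    under eq_integral do rewrite mul1r lcocycle_mul// mulrDr addrC expRD EFinM.
    rewrite ge0_integralZl ?lee_fin ?expR_ge0//.
    rewrite mul1r muleC; apply: lee_pmul => //.
    + by apply: integral_ge0 => h _; rewrite lee_fin expR_ge0.
    + by apply: HU => //; [exists a; exact: set_mem|exact: SL2_mulmx_neq0].
    + rewrite lee_fin ler_expR mulNr -mulrN ler_wnM2l//.
      exact: lcocycle_ge.
Qed.

End decomposition.

(** * Superadditive sequences *)

Section fekete.
Local Open Scope classical_set_scope.
Local Open Scope ring_scope.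
Context {R : realType}.

(** Fekete's argument: dividing [n] by a good length [P], the remainder costs at most [c P]. The
    limit is the supremum of [l n / n], whence the bound at every [n]. *)
Lemma superadditive_cvg (l : nat -> R) (c : R) : (forall n, l n <= 0) ->
  (forall m n, l m + l n <= l (m + n)%N) -> (forall n, - (c * n%:R) <= l n) ->
  exists L : R, (n%:R^-1 * l n @[n --> \oo] --> L) /\ forall n, l n <= n%:R * L.
Proof.
move=> l0 ladd lc.
have c0 : 0 <= c by have := lc 1%N; have := l0 1%N; lra.
pose S := [set n.+1%:R^-1 * l n.+1 | n in [set: nat]].
have S0 : has_sup S.
  split; first by exists (1%:R^-1 * l 1%N), 0%N.
  by exists 0 => _ [n _ <-]; rewrite mulr_ge0_le0 ?invr_ge0.
pose L := sup S; exists L.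
have lL n : l n <= n%:R * L.
  case: n => [|n]; first by rewrite mul0r.
  by rewrite -ler_pdivrMl//; apply: sup_upper_bound => //; exists n.
split => //.
apply/cvgrPdist_le => e e0.
have e20 : 0 < e / 2 by lra.
have [_ [p _ <-] pL] := @sup_adherent _ S (e / 2) e20 S0.
set P := p.+1 in pL.
have P0 : 0 < P%:R :> R by rewrite ltr0n.
have lq q : q%:R * l P <= l (q * P)%N.
  elim: q => [|q IH]; first by rewrite mul0r mul0n; have := lc 0%N; rewrite mulr0 oppr0.
  by rewrite mulSn -natr1 mulrDl mul1r addrC (le_trans _ (ladd _ _))// lerD2l.
exists (Num.truncn (2 * c * P%:R / e)).+1 => // n /= nN.
have n0 : 0 < n%:R :> R by rewrite ltr0n; case: n nN.
have nbig : 2 * c * P%:R / e < n%:R.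
  by rewrite (lt_le_trans (truncnS_gt _))// ler_nat.
rewrite ltr_pdivrMr// in nbig.
have up : n%:R^-1 * l n <= L by rewrite ler_pdivrMl.
rewrite ger0_norm ?subr_ge0// lerBlDr -lerBlDl.
rewrite ler_pdivlMl//.
have := ladd (n %/ P * P)%N (n %% P)%N; rewrite -divn_eq => h1.
have h2 := lq (n %/ P)%N.
have h3 := lc (n %% P)%N.
have h4 : c * (n %% P)%:R <= c * P%:R.
  by rewrite ler_wpM2l// ler_nat ltnW// ltn_mod.
have h5 : n%:R * (P%:R^-1 * l P) <= (n %/ P)%:R * l P.
  rewrite mulrA ler_wnM2r// ler_pdivlMr// -natrM ler_nat; exact: leq_trunc_div.
have h6 : n%:R * (L - e / 2) <= n%:R * (P%:R^-1 * l P) by rewrite ler_pM2l// ltW.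
lra.
Qed.

End fekete.

(** * Existence and monotonicity of [k(t)] for [t <= 0] *)

Section exponents.
Local Open Scope classical_set_scope.
Local Open Scope ereal_scope.
Context {R : realType}.
Variables (mu : probability (SL2 R) R) (b : R).
Hypothesis b0 : (0 < b)%R.
Hypothesis mub : mu [set g | (b < lnorm g)%R] = 0.

Lemma le_integral_cst (P : probability (SL2 R) R) (f : SL2 R -> R) (c : R) :
  measurable_fun setT f -> (forall g, 0 <= f g)%R -> (forall g, f g <= c)%R ->
  \int[P]_g (f g)%:E <= c%:E.
Proof.
move=> mf f0 fc; have c0 : (0 <= c)%R := le_trans (f0 point) (fc point).
have -> : c%:E = \int[P]_g (cst c%:E g).
  by rewrite integral_cst// [X in _ * X](@probability_setT _ _ _ P) mule1.
apply: ge0_le_integral => //.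
- by move=> g _; rewrite lee_fin.
- exact/measurable_EFinP.
- by move=> g _; rewrite lee_fin.
Qed.

Lemma kfunE (t : R) : kfun mu t = limn (fun n => (n%:R^-1)%:E *
  lne (\int[convn mu n]_g (expR (t * lnorm g))%:E)).
Proof.
congr (lim (_ @ \oo)); apply/funext => n; congr (_ * lne _).
by apply: eq_integral => g _; rewrite /powR gt_eqF ?spnorm_gt0.
Qed.

(** Superadditivity comes from submultiplicativity of the norm and [t <= 0]; the bounded support
    provides the linear lower bound and keeps the logarithms finite. *)
Lemma kfun_cvg (t : R) : (t <= 0)%R -> exists L : R,
  [/\ kfun mu t = L%:E,
      ((n%:R^-1)%:E * lne (\int[convn mu n]_g (expR (t * lnorm g))%:E))
        @[n --> \oo] --> L%:E &
      forall n, \int[convn mu n]_g (expR (t * lnorm g))%:E <= (expR (n%:R * L))%:E].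
Proof.
move=> t0; pose M n := \int[convn mu n]_g (expR (t * lnorm g))%:E.
have mE := measurable_expR_lnorm t.
have mEE : measurable_fun setT (fun g => (expR (t * lnorm g))%:E).
  exact/measurable_EFinP.
have M1 n : M n <= 1.
  apply: le_integral_cst => // g; rewrite ?expR_ge0//.
  by rewrite -[leRHS]expR0 ler_expR mulr_le0_ge0 ?lnorm_ge0.
have Mlow n : (expR (t * b * n%:R))%:E <= M n.
  have -> : (expR (t * b * n%:R))%:E = \int[convn mu n]_g (cst (expR (t * b * n%:R))%:E g).
    by rewrite integral_cst// [X in _ * X](@probability_setT _ _ _ (convn mu n)) mule1.
  apply: (le_integral_convn mu b mub) => // [g|g gn]; first by rewrite lee_fin expR_ge0.
  by rewrite lee_fin ler_expR -mulrA ler_wnM2l.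
have Mfin n : M n \is a fin_num.
  by rewrite ge0_fin_numE ?(le_lt_trans (M1 n)) ?ltry// integral_ge0.
pose l n := ln (fine (M n)).
have M0 n : (0 < fine (M n))%R.
  by rewrite -lte_fin fineK// (lt_le_trans _ (Mlow n))// lte_fin expR_gt0.
have lneM n : lne (M n) = (l n)%:E by rewrite -(fineK (Mfin n)) lne_EFin.
have Ml n : M n = (expR (l n))%:E by rewrite lnK ?posrE// fineK.
have [|||L [cvL lL]] := @superadditive_cvg R l (- (t * b))%R.
- by move=> n; rewrite -ler_expR expR0 -lee_fin -Ml.
- move=> m n; rewrite -ler_expR expRD -lee_fin EFinM -!Ml.
  rewrite /M (@integral_conv_split _ _ b m (m + n))// ?leq_addr// addKn.
  rewrite muleC -ge0_integralZl//; last by rewrite integral_ge0.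
  apply: ge0_le_integral => //.
  + by move=> g _; rewrite mule_ge0// integral_ge0.
  + exact: measurable_funeM.
  + apply: (measurable_fun_fubini_tonelli_F (m2 := convn mu n)
      (fun z : SL2 R * SL2 R => (expR (t * lnorm (SL2_mul z.2 z.1)))%:E)) => //.
    by apply: (measurableT_comp mEE); exact: measurable_SL2_mul2.
  + move=> g _; rewrite muleC -ge0_integralZl//.
    apply: ge0_le_integral.
    * exact: measurableT.
    * by move=> h _; rewrite -EFinM lee_fin mulr_ge0 ?expR_ge0.
    * exact: measurable_funeM.
    * by apply: (measurableT_comp mEE); exact: measurable_SL2_mul2.
    * move=> h _; rewrite -EFinM lee_fin -expRD -mulrDr ler_expR ler_wnM2l//.
      by rewrite addrC lnorm_mul.
- by move=> n; rewrite mulNr opprK -ler_expR -lee_fin -(Ml n); exact: Mlow.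
have cvgL : ((n%:R^-1)%:E * lne (M n)) @[n --> \oo] --> L%:E.
  under eq_fun do rewrite lneM -EFinM.
  by apply/fine_cvgP; split; [exact: nearW|exact: cvL].
exists L; split=> //.
- by rewrite kfunE; apply/cvg_lim.
- by move=> n; rewrite -/(M n) Ml lee_fin ler_expR.
Qed.

Lemma kfun_nondecreasing (s t : R) : (s <= t)%R -> (t <= 0)%R -> kfun mu s <= kfun mu t.
Proof.
move=> st t0; have [L1 [-> c1 _]] := kfun_cvg s (le_trans st t0).
have [L2 [-> c2 _]] := kfun_cvg t t0.
apply: (lee_cvg_to c1 c2); apply: nearW => n.
apply: lee_wpmul2l; first by rewrite lee_fin invr_ge0.
rewrite lee_lne ?in_itv/= ?leey ?integral_ge0//.
apply: ge0_le_integral => //.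
- by apply/measurable_EFinP; exact: measurable_expR_lnorm.
- by apply/measurable_EFinP; exact: measurable_expR_lnorm.
- by move=> g _; rewrite lee_fin ler_expR ler_wpM2r ?lnorm_ge0.
Qed.

End exponents.

(** * Upper limits of sequences of extended reals *)

Section limsup.
Local Open Scope classical_set_scope.
Local Open Scope ereal_scope.
Context {R : realType}.
Implicit Types (u : (\bar R)^nat) (y : \bar R).

Lemma limn_esup_lt_near u y : limn_esup u < y ->
  exists N, forall n, (N <= n)%N -> u n < y.
Proof.
move=> /ereal_inf_lt[_ [V [N _ NV] <-] sy]; exists N => n Nn.
by apply: le_lt_trans sy; apply: ereal_sup_ubound; exists n => //; exact: NV.
Qed.

Lemma limn_esup_le_near u y N : (forall n, (N <= n)%N -> u n <= y) -> limn_esup u <= y.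
Proof.
move=> uy; apply: (@le_trans _ _ (ereal_sup (u @` [set n | (N <= n)%N]))).
  by apply: ereal_inf_lbound; exists [set n | (N <= n)%N] => //; exists N.
by apply: ge_ereal_sup => _ [n /= Nn <-]; exact: uy.
Qed.

Lemma le_limn_esup u v : (forall n, u n <= v n) -> limn_esup u <= limn_esup v.
Proof.
move=> uv; apply: le_ereal_inf_tmp => _ [V FV <-].
apply: (@le_trans _ _ (ereal_sup (u @` V))).
  by apply: ereal_inf_lbound; exists V.
apply: ge_ereal_sup => _ [n Vn <-]; apply: le_trans (uv n) _.
by apply: ereal_sup_ubound; exists n.
Qed.

End limsup.

(** * Passing between [I_gamma] and bounds on probabilities *)

Section rates.
Local Open Scope classical_set_scope.
Local Open Scope ereal_scope.
Context {R : realType}.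
Variables (mu : probability (SL2 R) R) (omega : SL2 R -> RP1 R).
Hypothesis omegaP : is_omega_minus omega.

Lemma measurable_Eset_gamma (gamma alpha eps : R) n x :
  measurable (Eset_gamma omega gamma alpha eps n x).
Proof.
have -> : Eset_gamma omega gamma alpha eps n x =
    [set g | `|n%:R^-1 * lnorm g - alpha| <= eps]%R `&`
    [set g | dP x (omega g) <= expR (- (n%:R * (gamma - eps) * alpha))]%R by [].
apply: measurableI; apply: measurable_set_le => //; last exact: measurable_dP_omega.
apply: measurableT_comp => //; apply: measurable_funB => //.
by apply: measurable_funM => //; exact: measurable_lnorm.
Qed.

Let rate (gamma alpha eps : R) := fun n : nat => (n%:R^-1)%:E *
  lne (ereal_sup (range (fun x => convn mu n (Eset_gamma omega gamma alpha eps n x)))).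

Let sup_ge0 (gamma alpha eps : R) n :
  0 <= ereal_sup (range (fun x => convn mu n (Eset_gamma omega gamma alpha eps n x))).
Proof.
apply: (@le_trans _ _ (convn mu n (Eset_gamma omega gamma alpha eps n (omega point)))) => //.
by apply: ereal_sup_ubound; exists (omega point).
Qed.

Let rate_le (gamma gamma' alpha eps eps' : R) n : (0 <= alpha)%R -> (gamma <= gamma')%R ->
  (eps' <= eps)%R -> rate gamma' alpha eps' n <= rate gamma alpha eps n.
Proof.
move=> al0 gg ee; apply: lee_wpmul2l; first by rewrite lee_fin invr_ge0.
rewrite lee_lne ?in_itv/= ?leey ?andbT ?sup_ge0//.
apply: ge_ereal_sup => _ [x _ <-].
apply: (@le_trans _ _ (convn mu n (Eset_gamma omega gamma alpha eps n x))); last first.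
  by apply: ereal_sup_ubound; exists x.
apply: le_measure; rewrite ?inE; try exact: measurable_Eset_gamma.
move=> g [h1 h2]; split; first exact: le_trans h1 ee.
apply: le_trans h2 _; rewrite ler_expR lerN2 ler_wpM2r// ler_wpM2l//.
by rewrite lerB.
Qed.

(** For [alpha >= 0] the events [Eset_gamma] grow with [eps], so the limit at [0] is an infimum, and
    a bound at a single [eps] bounds [Irate]. *)
Lemma IrateE (gamma alpha : R) : (0 <= alpha)%R -> Irate mu omega gamma alpha =
  ereal_inf ((fun eps => limn_esup (rate gamma alpha eps)) @` [set eps | 0 < eps]%R).
Proof.
move=> al0; pose f eps := limn_esup (rate gamma alpha eps).
have nd : {in Interval (BRight (0 : R)%R) +oo%O &, nondecreasing_fun f}.
  by move=> e e' _ _ ee; apply: le_limn_esup => n; exact: rate_le.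
have := @nondecreasing_at_right_cvge R f 0%R +oo%O isT nd.
move=> /cvg_lim fl.
rewrite /Irate.
have -> : [set eps : R | (0 < eps)%R] = [set` Interval (BRight (0 : R)%R) +oo%O].
  by apply/seteqP; split=> e; rewrite /= in_itv/= andbT.
exact: fl.
Qed.

Lemma Irate_nonincreasing (gamma gamma' alpha : R) : (0 <= alpha)%R ->
  (gamma <= gamma')%R -> Irate mu omega gamma' alpha <= Irate mu omega gamma alpha.
Proof.
move=> al0 gg; rewrite (IrateE gamma' alpha al0) (IrateE gamma alpha al0); apply: le_ereal_inf_tmp => _ [e e0 <-].
apply: (@le_trans _ _ (limn_esup (rate gamma' alpha e))).
  by apply: ereal_inf_lbound; exists e.
by apply: le_limn_esup => n; exact: rate_le.
Qed.

Lemma Irate_lt (gamma alpha y : R) : (0 <= alpha)%R -> Irate mu omega gamma alpha < y%:E ->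
  exists2 eps : R, (0 < eps)%R & exists N, forall n x, (N <= n)%N ->
    convn mu n (Eset_gamma omega gamma alpha eps n x) <= (expR (n%:R * y))%:E.
Proof.
move=> al0; rewrite (IrateE gamma alpha al0) => /ereal_inf_lt[_ [e /= e0 <-]] /limn_esup_lt_near[N HN].
(* [N.+1] keeps [n] positive; at [n = 0] the factor [n^-1] is [0] by convention. *)
exists e => //; exists N.+1 => n x Nn.
have n0 : (0 < n%:R :> R)%R by rewrite ltr0n; case: n Nn.
have := HN n (ltnW Nn); rewrite /rate.
set S := ereal_sup _ => h.
have S0 : 0 <= S by exact: sup_ge0.
apply: (@le_trans _ _ S); first by apply: ereal_sup_ubound; exists x.
have : lne S <= (n%:R * y)%:E.
  by rewrite EFinM -lee_pdivrMl// ltW.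
rewrite -[(n%:R * y)%:E](@expeRK R) lee_lne ?in_itv/= ?leey ?andbT//.
Qed.

Lemma Irate_le (gamma alpha y eps : R) N : (0 <= alpha)%R -> (0 < eps)%R ->
  (forall n x, (N <= n)%N ->
    convn mu n (Eset_gamma omega gamma alpha eps n x) <= (expR (n%:R * y))%:E) ->
  Irate mu omega gamma alpha <= y%:E.
Proof.
move=> al0 e0 HN; rewrite (IrateE gamma alpha al0).
apply: (@le_trans _ _ (limn_esup (rate gamma alpha eps))).
  by apply: ereal_inf_lbound; exists eps.
apply: (@limn_esup_le_near _ _ _ N.+1) => n Nn; rewrite /rate.
have n0 : (0 < n%:R :> R)%R by rewrite ltr0n; case: n Nn.
set S := ereal_sup _.
have SE : S <= (expR (n%:R * y))%:E.
  by apply: ge_ereal_sup => _ [x _ <-]; apply: HN; exact: ltnW.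
rewrite lee_pdivrMl// -EFinM.
have [S0|S0] := ltP S 0; first by rewrite le0_lneNy ?leNye// ltW.
by rewrite -[(n%:R * y)%:E](@expeRK R) lee_lne ?in_itv/= ?leey ?andbT ?lee_fin ?expR_ge0.
Qed.

End rates.

(** * Induction over compact sets, and linear against exponential growth *)

Section compactness.
Local Open Scope classical_set_scope.
Local Open Scope ring_scope.

(** If [Q K] failed, the sets [A] with [Q] true of [K] minus [A] would form a proper filter
    containing [K]. At a cluster point in [K], a neighbourhood [U] with [Q U] would have its
    complement in the filter, which is absurd. *)
Lemma compact_ind (T : topologicalType) (K : set T) (Q : set T -> Prop) :
  compact K -> Q set0 -> (forall A B, A `<=` B -> Q B -> Q A) ->
  (forall A B, Q A -> Q B -> Q (A `|` B)) ->
  (forall x, K x -> exists2 U, nbhs x U & Q U) -> Q K.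
Proof.
move=> cK Q0 Qsub QU Qloc; apply: contrapT => QK.
pose F : set (set T) := [set A | Q (K `\` A)].
have FF : ProperFilter F.
  split; first by rewrite /F /= setD0.
  split.
  - by rewrite /F /= setDT.
  - by move=> A B QA QB; rewrite /F /mkset setDIr; exact: QU.
  - by rewrite /F /=; move=> A B AB; apply: Qsub => x [Kx nBx]; split => // /AB.
have FK : F K by rewrite /F /= setDv.
have [x [Kx clx]] := cK F FF FK.
have [U xU QUU] := Qloc x Kx.
have [|y [nUy Uy]] := clx (~` U) U _ xU; last exact: nUy.
by apply: Qsub QUU => y [_ /contrapT].
Qed.

Context {R : realType}.

(** Uses [e^(2u) >= (1 + u)^2] with [u = eta n / 2]; beyond the threshold [8 |A| / eta^2] one has
    [u^2 >= 2 |A| n]. *)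
Lemma linear_le_expR (A eta : R) : 0 < eta ->
  exists N, forall n, (N <= n)%N -> A * (n%:R + 1) <= expR (eta * n%:R).
Proof.
move=> eta0; exists (Num.truncn (8 * `|A| / eta ^+ 2)).+1 => n nN.
have n1 : 1 <= n%:R :> R by rewrite ler1n; case: n nN.
have : 8 * `|A| / eta ^+ 2 < n%:R by rewrite (lt_le_trans (truncnS_gt _))// ler_nat.
rewrite ltr_pdivrMr ?exprn_gt0// => h.
have -> : eta * n%:R = eta * n%:R / 2 + eta * n%:R / 2 by field.
have en0 : 0 < eta * n%:R / 2 by rewrite divr_gt0// mulr_gt0// (lt_le_trans ltr01).
rewrite expRD.
apply: (@le_trans _ _ ((1 + eta * n%:R / 2) * (1 + eta * n%:R / 2))); last first.
  by rewrite ler_pM// ?expR_ge1Dx// addr_ge0// ltW.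
have h2 : 8 * `|A| * n%:R <= n%:R * eta ^+ 2 * n%:R.
  by rewrite ler_wpM2r// ltW.
have h3 : A * (n%:R + 1) <= `|A| * (n%:R + 1).
  by rewrite ler_wpM2r ?ler_norm// addr_ge0.
have h4 : `|A| * 1 <= `|A| * n%:R by rewrite ler_wpM2l.
nra.
Qed.

End compactness.

(** * Exponential bounds over the contracting sets, uniform in [alpha] *)

Section contraction.
Local Open Scope classical_set_scope.
Local Open Scope ereal_scope.
Context {R : realType}.
Variables (mu : probability (SL2 R) R) (b : R).
Hypothesis b0 : (0 < b)%R.
Hypothesis mub : mu [set g | (b < lnorm g)%R] = 0.
Variable omega : SL2 R -> RP1 R.
Hypothesis omegaP : is_omega_minus omega.
Variables (s c : R).
Hypothesis rate2 : forall alpha : R, (0 <= alpha <= b)%R ->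
  Irate mu omega 2 alpha <= (c - s * alpha)%:E.

Let near_contr (A : set R) (m : nat) (La : R) x : set (SL2 R) :=
  [set a | A (m%:R^-1 * lnorm a)%R /\ (dP x (omega a) <= La * expR (- 2 * lnorm a))%R].

Let measurable_near_contr A m La x : measurable A -> measurable (near_contr A m La x).
Proof.
move=> mA; have mell := @measurable_lnorm R; apply: measurableI.
  rewrite -[X in measurable X]setTI.
  by apply: (_ : measurable_fun setT (fun a => m%:R^-1 * lnorm a)%R) => //; exact: measurable_funM.
apply: measurable_set_le; first exact: measurable_dP_omega.
apply: measurable_funM => //; apply: (measurableT_comp (@measurable_expR R)).
exact: measurable_funM.
Qed.

Let measurable_integrand (D : set (SL2 R)) : measurable D ->
  measurable_fun setT (fun a => (\1_D a * expR (s * lnorm a))%:E).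
Proof.
move=> mD; apply/measurable_EFinP; apply: measurable_funM.
  exact: measurable_indic.
exact: measurable_expR_lnorm.
Qed.

(** The property fed to [compact_ind]. It has to pass to arbitrary subsets, hence the measurable
    superset [A']; [th] is the exponential slack tolerated in [La], and may depend on the set. *)
Let bounded_on (dl : R) (A : set R) := exists A' : set R,
  [/\ measurable A', A `<=` A' & exists (th B : R) (M : nat),
    [/\ (0 < th)%R, (0 <= B)%R & forall m (La : R) x, (M <= m)%N ->
      (La <= expR (m%:R * th))%R ->
      \int[convn mu m]_a (\1_(near_contr A' m La x) a * expR (s * lnorm a))%:E <=
      (B * expR (m%:R * (c + dl)))%:E]].

Let bounded_on_local (dl alpha : R) : (0 < dl)%R -> (0 <= alpha <= b)%R ->
  exists2 U, nbhs alpha U & bounded_on dl U.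
Proof.
move=> dl0 /andP[al0 alb].
have [|eps eps0 [N HN]] := @Irate_lt R mu omega omegaP 2 alpha (c - s * alpha + dl / 2)%R al0.
  by apply: le_lt_trans (rate2 alpha _) _; rewrite ?al0// lte_fin ltrDl divr_gt0.
(* With [r <= q = eps alpha / 4], the slack [e^(m q)] and twice the error [m r] in [lnorm a] fit
   into the tolerance [e^(m eps alpha)] of [Eset_gamma] at [gamma = 2]. At [alpha = 0] the condition
   there is [dP <= 1], and any positive [q] will do. *)
pose q : R := if alpha == 0%R then 1%R else (eps * alpha / 4)%R.
have q0 : (0 < q)%R.
  rewrite /q; case: ifPn => // aln0; rewrite divr_gt0// mulr_gt0//.
  by rewrite lt_neqAle eq_sym aln0.
pose r : R := (Num.min (Num.min eps (dl / (2 * (`|s| + 1)))) q)%R.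
have s1 : (0 < 2 * (`|s| + 1))%R by rewrite mulr_gt0// ltr_wpDl.
have r0 : (0 < r)%R by rewrite !lt_min eps0 q0 divr_gt0.
have reps : (r <= eps)%R by rewrite !ge_min lexx.
have rq : (r <= q)%R by rewrite !ge_min lexx !orbT.
have rs : (`|s| * r <= dl / 2)%R.
  have : (r <= dl / (2 * (`|s| + 1)))%R by rewrite !ge_min lexx !orbT.
  by rewrite ler_pdivlMr// => h; nra.
exists [set y | (`|y - alpha| <= r)%R].
  apply/nbhs_ballP; exists r => //= y; rewrite /ball /= distrC => /ltW.
  exact.
exists [set y | (`|y - alpha| <= r)%R]; split => //.
  by apply: measurable_set_le => //; apply: measurableT_comp => //; exact: measurable_funB.
exists q, 1%R, (maxn N 1); split => // m La x; rewrite geq_max => /andP[Nm m1] LaE.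
rewrite mul1r; have m0 : (0 < m%:R :> R)%R by rewrite ltr0n.
pose C : R := expR (m%:R * (s * alpha + dl / 2)).
have mE := measurable_Eset_gamma omega omegaP 2 alpha eps m x.
apply: (@le_trans _ _ (\int[convn mu m]_a (C%:E *
    (\1_(Eset_gamma omega 2 alpha eps m x) a)%:E))).
  apply: ge0_le_integral => //.
  - apply: measurable_integrand; apply: measurable_near_contr.
    by apply: measurable_set_le => //; apply: measurableT_comp => //; exact: measurable_funB.
  - by apply: measurable_funeM; apply/measurable_EFinP; exact: measurable_indic.
  - move=> a _; rewrite -EFinM lee_fin indicE.
    have [|_] := boolP (a \in _); last by rewrite mul0r mulr_ge0 ?expR_ge0.
    rewrite inE => -[/= ar ad]; rewrite mul1r indicE mem_set ?mulr1.
      rewrite ler_expR.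
      have -> : lnorm a = (m%:R * (m%:R^-1 * lnorm a))%R by rewrite mulrA mulfV ?mul1r ?gt_eqF.
      rewrite mulrCA ler_pM2l//.
      have -> : (s * (m%:R^-1 * lnorm a) = s * alpha + s * (m%:R^-1 * lnorm a - alpha))%R by ring.
      rewrite lerD2l (le_trans (ler_norm _))// normrM (le_trans _ rs)//.
      by rewrite ler_wpM2l.
    split; first by exact: le_trans ar reps.
    have [al00|aln0] := eqVneq alpha 0%R.
      by rewrite al00 mulr0 oppr0 expR0 dP_le1.
    apply: (le_trans ad); apply: (@le_trans _ _ (expR (m%:R * q) * expR (- 2 * lnorm a))%R).
      by rewrite ler_wpM2r ?expR_ge0.
    rewrite -expRD ler_expR.
    have qE : (q = eps * alpha / 4)%R by rewrite /q (negbTE aln0).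
    have : (m%:R * (alpha - r) <= lnorm a)%R.
      by rewrite -ler_pdivlMl//; move: ar; rewrite ler_distl => /andP[].
    have : (m%:R * r <= m%:R * q)%R by rewrite ler_pM2l.
    have : (0 < m%:R * q)%R by rewrite mulr_gt0.
    rewrite qE; lra.
rewrite ge0_integralZl ?lee_fin ?expR_ge0//; last first.
  by apply/measurable_EFinP; exact: measurable_indic.
rewrite integral_indic// setIT.
apply: le_trans (lee_wpmul2l _ (HN m x Nm)) _; first by rewrite lee_fin expR_ge0.
rewrite -EFinM lee_fin -expRD ler_expR -mulrDr ler_pM2l//; lra.
Qed.

Let bounded_on_segment (dl : R) : (0 < dl)%R -> bounded_on dl `[0%R, b]%classic.
Proof.
move=> dl0; apply: compact_ind; first exact: segment_compact.
- exists set0; split=> //; exists 1%R, 0%R, 0%N; split => // m La x _ _.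
  rewrite mul0r; under eq_integral => a _.
    rewrite indicE memNset ?mul0r; last by case.
    over.
  by rewrite integral0.
- move=> A B AB [B' [mB' BB' h]]; exists B'; split => //; exact: subset_trans BB'.
- move=> A B [A' [mA' AA' [th1 [B1 [M1 [th10 B10 H1]]]]]].
  move=> [B' [mB' BB' [th2 [B2 [M2 [th20 B20 H2]]]]]].
  exists (A' `|` B'); split; [exact: measurableU|exact: setUSS|].
  exists (Num.min th1 th2), (B1 + B2)%R, (maxn M1 M2); split.
  + by rewrite lt_min th10.
  + exact: addr_ge0.
  + move=> m La x; rewrite geq_max => /andP[M1m M2m] Lam.
    have L1 : (La <= expR (m%:R * th1))%R.
      by rewrite (le_trans Lam)// ler_expR ler_wpM2l// ge_min lexx.
    have L2 : (La <= expR (m%:R * th2))%R.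
      by rewrite (le_trans Lam)// ler_expR ler_wpM2l// ge_min lexx orbT.
    rewrite mulrDl EFinD; apply: le_trans (leeD (H1 m La x M1m L1) (H2 m La x M2m L2)).
    have mA := measurable_integrand _ (measurable_near_contr A' m La x mA').
    have mB := measurable_integrand _ (measurable_near_contr B' m La x mB').
    rewrite -ge0_integralD//; apply: ge0_le_integral => //.
    * by apply: measurable_integrand; apply: measurable_near_contr; exact: measurableU.
    * exact: emeasurable_funD.
    * move=> a _; rewrite -EFinD lee_fin -mulrDl ler_wpM2r ?expR_ge0// !indicE.
      have [|_] := boolP (a \in _); last by rewrite addr_ge0.
      rewrite inE => -[[Aa|Ba] da].
        by rewrite [in X in (_ <= X%:R + _)%R]mem_set ?lerDl.
      by rewrite [in X in (_ <= _ + X%:R)%R]mem_set ?lerDr.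
- by move=> alpha; rewrite /= in_itv /=; exact: bounded_on_local.
Qed.

Lemma contracting_bound (dl : R) : (0 < dl)%R -> exists2 B : R, (0 <= B)%R &
  forall n m r x, (m <= n)%N ->
  \int[convn mu m]_a (\1_(contracting b omega n m r x) a * expR (s * lnorm a))%:E <=
  (B * expR (dl * n%:R + m%:R * c))%:E.
Proof.
move=> dl0; have [A [mA bA [th [B0 [M [th0 B00 HB]]]]]] := bounded_on_segment dl dl0.
(* The trivial bound [e^(|s| b m)] is at most [e^(k m + m c)], hence at most [e^(dl n + m c)] as
   long as [m <= d' n] with [d' = dl / k]. *)
pose k := (`|s| * b + `|c| + 1)%R.
have k0 : (0 < k)%R by rewrite ltr_wpDl// addr_ge0// mulr_ge0// ltW.
pose d' := (dl / k)%R; have d'0 : (0 < d')%R by rewrite divr_gt0.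
have [N1 HN1] := linear_le_expR (expR (2 * b)) (d' * th) (mulr_gt0 d'0 th0).
pose N3 := (Num.truncn ((M%:R + 1) / d')).+1.
pose N := maxn N1 N3.
have triv n m r x : \int[convn mu m]_a
    (\1_(contracting b omega n m r x) a * expR (s * lnorm a))%:E <= (expR (`|s| * b * m%:R))%:E.
  apply: (@le_integral_cst _ (convn mu m)) => //.
    apply: measurable_funM; last exact: measurable_expR_lnorm.
    by apply: measurable_indic; exact: measurable_contracting.
  move=> a; rewrite indicE; have [|_] := boolP (a \in _); last by rewrite mul0r expR_ge0.
  rewrite inE => -[am _ _]; rewrite mul1r ler_expR -mulrA.
  apply: (le_trans (ler_norm _)); rewrite normrM ler_wpM2l//.
  by rewrite ger0_norm ?lnorm_ge0.
pose K := expR (k * N%:R).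
have km m : (`|s| * b * m%:R <= k * m%:R + m%:R * c)%R.
  have : (m%:R * (- c) <= m%:R * `|c|)%R by rewrite ler_wpM2l// -normrN ler_norm.
  have : (0 <= m%:R :> R)%R by [].
  rewrite /k; lra.
have K0 : (0 <= K)%R by exact: expR_ge0.
exists (1 + B0 + K)%R; first by rewrite addr_ge0// addr_ge0.
move=> n m r x mn; rewrite !mulrDl mul1r.
set E := expR (dl * n%:R + m%:R * c); have E0 : (0 <= E)%R by exact: expR_ge0.
have [mle|mgt] := leP (m%:R : R)%R (d' * n%:R)%R.
  apply: le_trans (triv n m r x) _; rewrite lee_fin.
  apply: (@le_trans _ _ E); last by rewrite -addrA lerDl addr_ge0// mulr_ge0.
  rewrite ler_expR (le_trans (km m))// lerD2r.
  have -> : (dl * n%:R = k * (d' * n%:R))%R by rewrite /d'; field; rewrite gt_eqF.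
  by rewrite ler_pM2l.
have [nN|Nn] := ltnP n N.
  apply: le_trans (triv n m r x) _; rewrite lee_fin.
  apply: (@le_trans _ _ (K * E)%R); last by rewrite lerDr addr_ge0// mulr_ge0.
  rewrite /K /E -expRD ler_expR (le_trans (km m))// addrA lerD2r.
  apply: (@le_trans _ _ (k * N%:R)%R); last by rewrite lerDl mulr_ge0// ltW.
  by rewrite ler_pM2l// ler_nat (leq_trans mn)// ltnW.
have /andP[N1n N3n] : (N1 <= n)%N && (N3 <= n)%N by rewrite -geq_max.
have Mm : (M <= m)%N.
  have : ((M%:R + 1) / d' < n%:R)%R by rewrite (lt_le_trans (truncnS_gt _))// ler_nat.
  rewrite ltr_pdivrMr// mulrC => h.
  by rewrite -(ler_nat R); lra.
have m1 : (0 < m%:R :> R)%R by rewrite (le_lt_trans _ mgt)// mulr_ge0// ltW.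
(* Now [m > d' n] with [n] large, so this factor, linear in [n], is below [e^(m th)]. *)
pose La : R := (n%:R * expR (2 * b) + 1)%R.
have LaE : (La <= expR (m%:R * th))%R.
  apply: (@le_trans _ _ (expR (2 * b) * (n%:R + 1))%R).
    rewrite /La mulrDr mulr1 [(n%:R * _)%R]mulrC lerD2l.
    by rewrite -[leLHS]expR0 ler_expR mulr_ge0// ltW.
  apply: (le_trans (HN1 n N1n)); rewrite ler_expR mulrAC ler_pM2r//; exact: ltW.
apply: (@le_trans _ _ (B0 * E)%:E); last first.
  by rewrite lee_fin -addrA addrC -addrA lerDl addr_ge0// mulr_ge0.
apply: le_trans (le_trans (HB m La x Mm LaE) _); last first.
  rewrite lee_fin ler_wpM2l// ler_expR mulrDr addrC lerD2r mulrC ler_pM2l//.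
  by rewrite ler_nat.
apply: (le_integral_convn mu b mub) => //.
- by apply: measurable_integrand; exact: measurable_contracting.
- by apply: measurable_integrand; exact: measurable_near_contr.
- move=> a am; rewrite lee_fin ler_wpM2r ?expR_ge0// !indicE.
  have [|//] := boolP (a \in contracting _ _ _ _ _ _).
  rewrite inE => -[_ _ ad]; rewrite mem_set//; split => //.
  apply: bA; rewrite /= in_itv/= mulr_ge0 ?lnorm_ge0 ?invr_ge0//=.
  by rewrite ler_pdivrMl// mulrC.
Qed.

End contraction.

(** * Growth of [int |g x|^t], and the resulting bound on [I_gamma] *)

Section rate_bounds.
Local Open Scope classical_set_scope.
Local Open Scope ereal_scope.
Context {R : realType}.
Variables (mu : probability (SL2 R) R) (b : R).
Hypothesis b0 : (0 < b)%R.
Hypothesis mub : mu [set g | (b < lnorm g)%R] = 0.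
Variable omega : SL2 R -> RP1 R.
Hypothesis omegaP : is_omega_minus omega.
Variables (t k : R).
Hypothesis t0 : (t <= 0)%R.
Hypothesis kM : forall n,
  \int[convn mu n]_g (expR (t * lnorm g))%:E <= (expR (n%:R * k))%:E.

Lemma lee_sum_cst n (F : nat -> \bar R) (C : R) :
  (forall m, (m <= n)%N -> F m <= C%:E) ->
  \sum_(m < n.+1) F m <= ((n%:R + 1) * C)%:E.
Proof.
move=> FC; apply: (@le_trans _ _ (\sum_(m < n.+1) C%:E)).
  by apply: lee_sum => m _; apply: FC; rewrite leq_ord.
by rewrite sumEFin sumr_const card_ord lee_fin natr1 mulr_natl.
Qed.

Lemma integral_lcocycle_le n v : v != 0%R ->
  \int[convn mu n]_g (expR (t * lcocycle g v))%:E <= (expR (- t * b * n%:R))%:E.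
Proof.
move=> v0.
have -> : (expR (- t * b * n%:R))%:E =
    \int[convn mu n]_g (cst (expR (- t * b * n%:R))%:E g).
  by rewrite integral_cst// [X in _ * X](@probability_setT _ _ _ (convn mu n)) mule1.
apply: (le_integral_convn mu b mub) => //.
- by apply/measurable_EFinP; exact: measurable_expR_lcocycle.
- by move=> g; rewrite lee_fin expR_ge0.
- move=> g gn; rewrite lee_fin ler_expR -mulrA mulNr -mulrN ler_wnM2l//.
  by apply: le_trans (lcocycle_ge g v v0); rewrite lerN2.
Qed.

(* Only the times [m >= d' n] contribute to the decomposition beyond the
   threshold [r], so the bound at [n] follows from the bounds at [n - m < n]. *)
Lemma cocycle_bound (c dl : R) : (c < k)%R ->
  (forall alpha : R, (0 <= alpha <= b)%R ->
    Irate mu omega 2 alpha <= (c - (- t) * alpha)%:E) -> (0 < dl)%R ->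
  exists2 B : R, (0 <= B)%R & forall n v, v != 0%R ->
    \int[convn mu n]_g (expR (t * lcocycle g v))%:E <= (B * expR (n%:R * (k + dl)))%:E.
Proof.
move=> ck rate2 dl0; pose kap := (k + dl)%R.
have kc : (0 < kap - c)%R by rewrite /kap; lra.
pose q := (4 * b * - t + 1)%R.
have bt : (0 <= b * - t)%R by rewrite mulr_ge0 ?oppr_ge0// ltW.
(* [q] ensures [2 b (- t) d' <= dl]: where [lnorm g - lcocycle g v < r], replacing [|g x|] by [|g|]
   costs at most a constant times [e^(dl n)]. *)
have q0 : (0 < q)%R by rewrite /q -mulrA; lra.
pose d' := (dl / q)%R; have d'0 : (0 < d')%R by rewrite divr_gt0.
have d'q : (d' * q = dl)%R by rewrite /d' divfK// gt_eqF.
(* For [m >= d' n] the gain [m (kap - c)] is at least [2 eta n]: one half pays for the loss in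
   [HB1], the other for the [n + 1] summands. *)
pose eta := (d' * (kap - c) / 2)%R.
have eta0 : (0 < eta)%R by rewrite divr_gt0// mulr_gt0.
have [B1 B10 HB1] := contracting_bound mu b b0 mub omega omegaP (- t) c rate2 eta eta0.
have [N1 HN1] := linear_le_expR (2 * B1) eta eta0.
pose N := maxn N1 1.
(* The first summand serves the part below the threshold, the second the lengths [n < N]. As [B]
   also bounds the remainders, the sum over [m] must come out below half of the target; hence the
   factor 2 in [HN1]. *)
pose B := (2 * expR (- 2 * b * t) + expR (- t * b * N%:R + `|kap| * N%:R))%R.
have B0 : (0 <= B)%R by rewrite addr_ge0 ?mulr_ge0 ?expR_ge0.
exists B => // n; have [p] := ubnP n; elim: p n => // p IH n; rewrite ltnS => np v v0.
rewrite -/kap; have [nN|] := ltnP n N.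
  apply: le_trans (integral_lcocycle_le n v v0) _; rewrite lee_fin.
  apply: (@le_trans _ _ (expR (- t * b * N%:R + `|kap| * N%:R) * expR (n%:R * kap))%R).
    rewrite -expRD ler_expR -addrA -[leLHS]addr0 lerD//.
      apply: ler_wpM2l; last by rewrite ler_nat (ltnW nN).
      by rewrite mulr_ge0 ?oppr_ge0// (ltW b0).
    have h1 : (n%:R * - kap <= n%:R * `|kap|)%R by rewrite ler_wpM2l// -normrN ler_norm.
    have h2 : (n%:R * `|kap| <= N%:R * `|kap|)%R by rewrite ler_wpM2r// ler_nat (ltnW nN).
    lra.
  by rewrite ler_wpM2r ?expR_ge0// lerDr mulr_ge0 ?expR_ge0.
rewrite geq_max => /andP[N1n n1].
have n1' : (1 <= n%:R :> R)%R by rewrite ler1n.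
have [x xv] := RP1_line v v0.
pose r := (2 * b * d' * n%:R + 2 * b)%R.
pose S := [set g : SL2 R | r <= lnorm g - lcocycle g v]%R.
have mS : measurable S.
  apply: measurable_set_le => //; apply: measurable_funB.
    exact: measurable_lnorm.
  exact: measurable_lcocycle.
have mSe : measurable_fun setT (fun g => (\1_S g * expR (t * lcocycle g v))%:E).
  apply/measurable_EFinP; apply: measurable_funM; first exact: measurable_indic.
  exact: measurable_expR_lcocycle.
have mne : measurable_fun setT (fun g : SL2 R => (expR (t * lnorm g))%:E).
  by apply/measurable_EFinP; exact: measurable_expR_lnorm.
apply: (@le_trans _ _ (\int[convn mu n]_g ((expR (- t * r))%:E * (expR (t * lnorm g))%:E +
    (\1_S g * expR (t * lcocycle g v))%:E))).
  apply: ge0_le_integral => //.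
  - by apply/measurable_EFinP; exact: measurable_expR_lcocycle.
  - by apply: emeasurable_funD => //; exact: measurable_funeM.
  - move=> g _; rewrite -EFinM -EFinD lee_fin indicE.
    have [_|] := boolP (g \in S).
      by rewrite mul1r lerDr mulr_ge0 ?expR_ge0.
    rewrite notin_setE /S /= => /negP; rewrite -ltNge => gr.
    rewrite mul0r addr0 -expRD ler_expR mulNr -mulrN -mulrDr ler_wnM2l//; lra.
rewrite ge0_integralD//; last exact: measurable_funeM.
rewrite ge0_integralZl ?lee_fin ?expR_ge0//.
have -> : (B * expR (n%:R * kap) = B / 2 * expR (n%:R * kap) + B / 2 * expR (n%:R * kap))%R.
  by field.
rewrite EFinD; apply: leeD.
  apply: le_trans (lee_wpmul2l _ (kM n)) _; first by rewrite lee_fin expR_ge0.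
  rewrite -EFinM lee_fin -expRD.
  apply: (@le_trans _ _ (expR (- 2 * b * t) * expR (n%:R * kap))%R).
    rewrite -expRD ler_expR /r /kap.
    have : (2 * (b * - t) * d' <= dl)%R by rewrite -d'q /q; nra.
    move=> /(ler_wpM2r (ler0n R n)); nra.
  rewrite ler_wpM2r ?expR_ge0// /B.
  by have := expR_ge0 (- t * b * N%:R + `|kap| * N%:R); lra.
pose U m := (B * expR ((n - m)%:R * kap))%R.
have Um m : contracting b omega n m r x !=set0 -> (d' * n%:R <= m%:R)%R.
  move=> [a [am ra _]]; have : (b * (d' * n%:R) <= b * m%:R)%R by rewrite /r in ra; lra.
  by rewrite ler_pM2l.
apply: le_trans (@decomposition _ mu b b0 mub omega omegaP n r t x v U t0 v0 xv _ _) _.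
- by move=> m; rewrite mulr_ge0 ?expR_ge0.
- move=> m mn /Um dm u u0; apply: IH => //.
  rewrite (leq_trans _ np)// ltn_subrL n1 andbT -(ltr_nat R).
  by rewrite (lt_le_trans _ dm)// mulr_gt0// ltr0n.
pose F m := (U m)%:E * \int[convn mu m]_g
  (\1_(contracting b omega n m r x) g * expR (- t * lnorm g))%:E.
apply: (@le_trans _ _ ((n%:R + 1) * (B * B1 * expR (n%:R * kap - eta * n%:R)))%:E).
  apply: (@lee_sum_cst n F).
  move=> m mn; have [/Um dm|] := pselect (contracting b omega n m r x !=set0).
    apply: le_trans (lee_wpmul2l _ (HB1 n m r x mn)) _; first by rewrite lee_fin mulr_ge0 ?expR_ge0.
    rewrite -EFinM lee_fin /U mulrACA -expRD ler_wpM2l ?mulr_ge0// ler_expR.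
    rewrite natrB//; have : (d' * n%:R * (kap - c) <= m%:R * (kap - c))%R by rewrite ler_pM2r.
    by rewrite /eta; lra.
  rewrite /F => /set0P/negP/negPn/eqP ->; under eq_integral do rewrite indic0 mul0r.
  by rewrite integral0 mule0 lee_fin mulr_ge0 ?mulr_ge0 ?expR_ge0.
rewrite lee_fin expRB.
have := HN1 n N1n; set E := expR (eta * n%:R) => hE.
have E0 : (0 < E)%R by exact: expR_gt0.
rewrite !mulrA ler_pdivrMr//.
rewrite [leLHS](_ : _ = B / 2 * expR (n%:R * kap) * (2 * B1 * (n%:R + 1)))%R; last by field.
by rewrite ler_wpM2l// mulr_ge0 ?expR_ge0// divr_ge0.
Qed.

(** On the event [E] the product expands [x] by at most [e^y], so by [t <= 0] its probability is at
    most [e^(- t y)] times the integral of [|g x|^t] over [S]. The hypothesis on [I_2] has slope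
    [- t + 2 z], the exponent of [|a|] left after the factor [|a|^(- 2 z)] is estimated by [r]. *)
Lemma Irate_upper_bound (z alpha gamma : R) :
  (forall dl : R, (0 < dl)%R -> exists2 B : R, (0 <= B)%R & forall n v, v != 0%R ->
    \int[convn mu n]_g (expR (t * lcocycle g v))%:E <= (B * expR (n%:R * (k + dl)))%:E) ->
  (0 <= z)%R -> (forall beta : R, (0 <= beta <= b)%R ->
    Irate mu omega 2 beta <= (k - (- t + 2 * z) * beta)%:E) ->
  (0 <= alpha)%R -> (gamma <= 2)%R ->
  Irate mu omega gamma alpha + (t * (1 - gamma) * alpha)%:E <=
    (k - z * (gamma * alpha))%:E.
Proof.
move=> cb z0 rate2 al0 g2.
rewrite -leeBrDr// -EFinB; apply/lee_addgt0Pr => dl dl0; rewrite -EFinD.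
have d40 : (0 < dl / 4)%R by rewrite divr_gt0.
have [B2 B20 HB2] := cb _ d40.
have [B1 B10 HB1] := contracting_bound mu b b0 mub omega omegaP (- t + 2 * z) k rate2 _ d40.
(* [K] dominates the errors of order [eps], which enter through [y] with factor [- t] and through
   [r] with factor [z]. The quarters of [dl] go to [HB2], [HB1], these errors and the [n + 1]
   summands. *)
pose K := ((2 * z - t) * (1 + alpha) + 1)%R.
have zt0 : (0 <= 2 * z - t)%R by rewrite subr_ge0 (le_trans t0)// mulr_ge0.
have K0 : (0 < K)%R by rewrite ltr_wpDl// mulr_ge0// addr_ge0.
pose eps := (dl / 4 / K)%R; have eps0 : (0 < eps)%R by rewrite divr_gt0.
have epsK : (eps * K = dl / 4)%R by rewrite /eps divfK// gt_eqF.
(* The factors independent of [n]: [2 b z] comes from [contracting], the terms in [ln 2] from [r]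
   and [y]. *)
pose C := (B1 * B2 * expR (2 * b * z + z * ln 2 - t * ln 2))%R.
have [N HN] := linear_le_expR C (dl / 4) d40.
apply: (@Irate_le R mu omega omegaP gamma alpha _ eps N.+1 al0 eps0) => n x Nn.
have n0 : (0 < n%:R :> R)%R by rewrite ltr0n; case: n Nn.
have [v v0 xv] := RP1_gen x.
pose e' := (eps * (1 + alpha))%R.
pose y := (ln 2 + n%:R * ((1 - gamma) * alpha + e'))%R.
pose r := (n%:R * (gamma * alpha - eps - e') - ln 2)%R.
set E := Eset_gamma _ _ _ _ _ _; have mE : measurable E by exact: measurable_Eset_gamma.
pose S := [set g : SL2 R | r <= lnorm g - lcocycle g v]%R.
have mS : measurable S.
  apply: measurable_set_le => //; apply: measurable_funB.
    exact: measurable_lnorm.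
  exact: measurable_lcocycle.
have Ey g : E g -> (lcocycle g v <= y)%R /\ S g.
  move=> []; rewrite /Eset /mkset -/(lnorm g) ler_distl => /andP[l1 l2] dg.
  have l1' : (n%:R * (alpha - eps) <= lnorm g)%R by rewrite -ler_pdivlMl.
  have l2' : (lnorm g <= n%:R * (alpha + eps))%R by rewrite -ler_pdivrMl.
  have ly : (lcocycle g v <= y)%R.
    rewrite -ler_expR; apply: le_trans (lcocycle_omega_le omega omegaP g x v v0 xv) _.
    rewrite /y expRD lnK ?posrE//; set Y := expR (n%:R * _).
    have -> : (2 * Y = Y + Y)%R by ring.
    apply: lerD.
      apply: le_trans (ler_wpM2l (expR_ge0 _) dg) _; rewrite -expRD ler_expR /e'; nra.
    (* The term [|g|^-1] is about [e^(- n alpha)]; here [gamma <= 2] gives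
       [- alpha <= (1 - gamma) alpha]. *)
    rewrite ler_expR /e'.
    have : (0 <= n%:R * ((2 - gamma) * alpha))%R by rewrite mulr_ge0 ?mulr_ge0// ?subr_ge0// ltW.
    have : (0 <= n%:R * (eps * alpha))%R := mulr_ge0 (ltW n0) (mulr_ge0 (ltW eps0) al0).
    lra.
  split=> //; rewrite /S /= /r; rewrite /y in ly; lra.
have tyP : (0 < expR (t * y))%R by exact: expR_gt0.
have low : (expR (t * y))%:E * convn mu n E <=
    \int[convn mu n]_g (\1_S g * expR (t * lcocycle g v))%:E.
  rewrite -[E]setIT -integral_indic// -ge0_integralZl ?lee_fin ?expR_ge0//; last first.
    by apply/measurable_EFinP; exact: measurable_indic.
  apply: ge0_le_integral => //.
  - by apply: measurable_funeM; apply/measurable_EFinP; exact: measurable_indic.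
  - apply/measurable_EFinP; apply: measurable_funM; first exact: measurable_indic.
    exact: measurable_expR_lcocycle.
  - move=> g _; rewrite -EFinM lee_fin [X in (_ * X <= _)%R]indicE.
    have [|_] := boolP (g \in E); last by rewrite mulr0 mulr_ge0 ?expR_ge0.
    rewrite inE => /Ey[ly Sg]; rewrite mulr1 indicE mem_set// mul1r ler_expR.
    exact: ler_wnM2l.
pose U m := (B2 * expR ((n - m)%:R * (k + dl / 4)))%R.
have up : \int[convn mu n]_g (\1_S g * expR (t * lcocycle g v))%:E <=
    ((n%:R + 1) * (B1 * B2 * expR (- z * (r - 2 * b)) * expR (n%:R * (k + dl / 2))))%:E.
  apply: le_trans (@decomposition _ mu b b0 mub omega omegaP n r t x v U t0 v0 xv _ _) _.
  - by move=> m; rewrite mulr_ge0 ?expR_ge0.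
  - by move=> m mn _ u u0; exact: HB2.
  pose F m := (U m)%:E * \int[convn mu m]_g
    (\1_(contracting b omega n m r x) g * expR (- t * lnorm g))%:E.
  apply: (@lee_sum_cst n F) => m mn; rewrite /F.
  have mD := measurable_contracting b omega omegaP n m r x.
  apply: (@le_trans _ _ ((U m)%:E * ((expR (- z * (r - 2 * b)))%:E *
      (B1 * expR (dl / 4 * n%:R + m%:R * k))%:E))).
    apply: lee_wpmul2l; first by rewrite lee_fin mulr_ge0 ?expR_ge0.
    apply: le_trans (lee_wpmul2l _ (HB1 n m r x mn)); last by rewrite lee_fin expR_ge0.
    have mI (s : R) : measurable_fun setT
        (fun a => (\1_(contracting b omega n m r x) a * expR (s * lnorm a))%:E).
      apply/measurable_EFinP; apply: measurable_funM; first exact: measurable_indic.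
      exact: measurable_expR_lnorm.
    rewrite -ge0_integralZl ?lee_fin ?expR_ge0//.
    apply: ge0_le_integral => //; first exact: measurable_funeM.
    move=> a _; rewrite -EFinM lee_fin indicE.
    have [|_] := boolP (a \in _); last by rewrite !mul0r mulr0.
    rewrite inE => -[_ ra _]; rewrite !mul1r -expRD ler_expR.
    have : (z * (r - 2 * b) <= z * (2 * lnorm a))%R by rewrite ler_wpM2l//; lra.
    lra.
  rewrite -!EFinM lee_fin /U.
  have -> : (B2 * expR ((n - m)%:R * (k + dl / 4)) * (expR (- z * (r - 2 * b)) *
     (B1 * expR (dl / 4 * n%:R + m%:R * k))) = B1 * B2 * expR (- z * (r - 2 * b)) *
     (expR ((n - m)%:R * (k + dl / 4)) * expR (dl / 4 * n%:R + m%:R * k)))%R by ring.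
  rewrite ler_wpM2l ?mulr_ge0 ?expR_ge0// -expRD ler_expR natrB//.
  have : (0 <= m%:R * (dl / 4))%R by rewrite mulr_ge0// ltW.
  lra.
have := le_trans low up; rewrite -lee_pdivlMl// => /le_trans; apply.
rewrite -EFinM lee_fin -expRN.
apply: (@le_trans _ _ (C * (n%:R + 1) *
    expR (n%:R * (k - z * (gamma * alpha) - t * (1 - gamma) * alpha + dl * 3 / 4)))%R).
  have -> : (expR (- (t * y)) * ((n%:R + 1) * (B1 * B2 * expR (- z * (r - 2 * b)) *
    expR (n%:R * (k + dl / 2)))) = B1 * B2 * (n%:R + 1) *
    (expR (- (t * y)) * expR (- z * (r - 2 * b)) * expR (n%:R * (k + dl / 2))))%R by ring.
  rewrite /C [leRHS](_ : _ = B1 * B2 * (n%:R + 1) * (expR (2 * b * z + z * ln 2 - t * ln 2) *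
    expR (n%:R * (k - z * (gamma * alpha) - t * (1 - gamma) * alpha + dl * 3 / 4))))%R; last by ring.
  rewrite ler_wpM2l ?mulr_ge0 ?addr_ge0// -!expRD ler_expR /y /r.
  have h : (z * (eps + e') - t * e' <= dl / 4)%R.
    rewrite -epsK /K /e'.
    have : (0 <= eps * (z * alpha))%R := mulr_ge0 (ltW eps0) (mulr_ge0 z0 al0).
    by nra.
  have := ler_wpM2l (ltW n0) h; lra.
have := HN n (ltnW Nn) => /(ler_wpM2r (expR_ge0 (n%:R *
  (k - z * (gamma * alpha) - t * (1 - gamma) * alpha + dl * 3 / 4)))) /le_trans; apply.
rewrite -expRD ler_expR le_eqVlt; apply/orP; left; apply/eqP; by field.
Qed.

End rate_bounds.

(** * What [A] and [t_c] say about [I_2] *)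

Section rate_two.
Local Open Scope classical_set_scope.
Local Open Scope ereal_scope.
Context {R : realType}.
Variables (mu : probability (SL2 R) R) (omega : SL2 R -> RP1 R).
Hypothesis omegaP : is_omega_minus omega.

(** Outside [A] the rate [I_0] is [-oo], and [I_2 <= I_0]. *)
Lemma Irate2_le (s c : R) :
  (forall alpha, Aset mu omega alpha -> Irate mu omega 2 alpha <= (c - s * alpha)%:E) ->
  forall alpha : R, (0 <= alpha)%R -> Irate mu omega 2 alpha <= (c - s * alpha)%:E.
Proof.
move=> HA alpha al0; have [|nA] := pselect (Aset mu omega alpha); first exact: HA.
have I0 : Irate mu omega 0 alpha = -oo.
  apply/eqP; rewrite eq_le leNye andbT leNgt; apply/negP => h; exact: nA.
apply: le_trans (Irate_nonincreasing mu omega omegaP 0 2 alpha al0 _) _ => //.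
by rewrite I0 leNye.
Qed.

(** The infimum provides some [t' < t] with the strict inequality; [k(t') <= k(t)] and
    [t' alpha <= t alpha] carry it to [t]. *)
Lemma lt_tc_gap (b t k : R) : mu [set g | (b < lnorm g)%R] = 0 ->
  tc mu omega < t%:E -> (t <= 0)%R -> kfun mu t = k%:E ->
  exists2 c : R, (c < k)%R &
    forall alpha, Aset mu omega alpha -> Irate mu omega 2 alpha <= (c + t * alpha)%:E.
Proof.
move=> mub /ereal_inf_lt[_ [t' /= tc' <-]]; rewrite lte_fin => tt' t0 kt.
have := lt_le_trans tc' (kfun_nondecreasing mu b mub t' t (ltW tt') t0).
rewrite kt; set J := ereal_sup _ => Jk.
have [c Jc ck] : exists2 c : R, J <= c%:E & (c < k)%R.
  case: J Jk => [j|//|_]; first by rewrite lte_fin => jk; exists j.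
  by exists (k - 1)%R; rewrite ?leNye// ltrBlDr ltrDl.
exists c => // alpha A; have al0 : (0 <= alpha)%R by case: A.
have : Irate mu omega 2 alpha - (t' * alpha)%:E <= c%:E.
  by apply: le_trans Jc; apply: ereal_sup_ubound; exists alpha.
rewrite leeBlDr// => /le_trans; apply.
by rewrite -EFinD lee_fin lerD2l ler_wpM2r// ltW.
Qed.

End rate_two.

Theorem theorem1p7 (R : realType) (mu : probability (SL2 R) R)
    (omega : SL2 R -> RP1 R)
    (mu_compact : compactly_supported mu)
    (mu_irreducible : strongly_irreducible mu)
    (mu_proximal : proximal mu)
    (omegaP : is_omega_minus omega)
    (t : R) (t_gt : (tc mu omega < t%:E)%E) (t_le0 : (t <= 0)%R)
    (alpha : R) (alphaA : Aset mu omega alpha)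
    (gamma : R) (gamma_ge0 : (0 <= gamma)%R) (gamma_le2 : (gamma <= 2)%R) :
  (Irate mu omega gamma alpha + (t * (1 - gamma) * alpha)%:E
     <= kfun mu t - zeta mu omega t * (gamma * alpha)%:E)%E.
Proof.
have [b b0 mub] := lnorm_bounded mu mu_compact.
have [k [kt _ kM]] := kfun_cvg mu b mub t t_le0.
have [c ck HA] := lt_tc_gap mu omega b t k mub t_gt t_le0 kt.
have al0 : (0 <= alpha)%R by case: alphaA.
have rate2 (a : R) : (0 <= a <= b)%R -> (Irate mu omega 2 a <= (c - (- t) * a)%:E)%E.
  move=> /andP[a0 _]; apply: (Irate2_le mu omega omegaP) => // {a0}a A.
  by rewrite mulNr opprK; exact: HA.
have cb (dl : R) := cocycle_bound mu b b0 mub omega omegaP t k t_le0 kM c dl ck rate2.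
rewrite kt; set I := (_ + _)%E.
pose Z := [set z : R | (ereal_sup [set Irate mu omega 2 a - (t * a)%:E + (2 * z * a)%:E
  | a in Aset mu omega] < kfun mu t)%E]%classic.
have Zle z : (0 <= z)%R -> Z z -> (I <= (k - z * (gamma * alpha))%:E)%E.
  move=> z0; rewrite /Z /= kt => Zz.
  apply: (Irate_upper_bound mu b b0 mub omega omegaP t k t_le0 z alpha gamma cb z0 _ al0 gamma_le2).
  move=> beta /andP[be0 _]; apply: (Irate2_le mu omega omegaP) => // {be0}beta A.
  have : (Irate mu omega 2 beta - (t * beta)%:E + (2 * z * beta)%:E <= k%:E)%E.
    by apply: le_trans (ltW Zz); apply: ereal_sup_ubound; exists beta.
  by rewrite -leeBrDr// leeBlDr// -EFinB -EFinD => /le_trans; apply; rewrite lee_fin; lra.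
(* The gap makes [z = 0] admissible, so [I <= k]; this excludes [I = +oo] and settles all negative
   [z]. *)
have Z0 : Z 0%R.
  rewrite /Z /= kt; apply: (@le_lt_trans _ _ c%:E); last by rewrite lte_fin.
  apply: ge_ereal_sup => _ [a A <-]; rewrite mulr0 mul0r adde0 -leeBrDr// -EFinB opprK.
  exact: HA.
have I0 := Zle 0%R (lexx _) Z0; rewrite mul0r subr0 in I0.
have ga0 : (0 <= gamma * alpha)%R by rewrite mulr_ge0.
have IZ z : Z z -> (I <= (k - z * (gamma * alpha))%:E)%E.
  have [z0|z0] := leP 0%R z; first exact: Zle.
  move=> _; apply: le_trans I0 _; rewrite lee_fin lerBrDl gerDr.
  by rewrite nmulr_rle0.
case: I {Zle} I0 IZ => [q||]//; last by move=> *; rewrite leNye.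
rewrite lee_fin => qk IZ.
(* If [gamma * alpha = 0], its product with [zeta] is [0] whatever the extended real [zeta] is.
   Otherwise division by it turns the bounds at all admissible [z] into one on their supremum. *)
have [ga|gaN] := eqVneq (gamma * alpha)%R 0%R.
  by rewrite ga mule0 sube0 lee_fin.
have gap : (0 < gamma * alpha)%R by rewrite lt_neqAle eq_sym gaN.
have zw : (zeta mu omega t <= ((k - q) / (gamma * alpha))%:E)%E.
  apply: ge_ereal_sup => _ [z Zz <-]; rewrite lee_fin ler_pdivlMr//.
  by have := IZ z Zz; rewrite lee_fin; lra.
have : (zeta mu omega t * (gamma * alpha)%:E <= (k - q)%:E)%E.
  apply: le_trans (lee_wpmul2r _ zw) _; first by rewrite lee_fin.
  by rewrite -EFinM divfK.
by move=> h; apply: le_trans (leeB (lexx k%:E) h); rewrite -EFinB lee_fin; lra.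
Qed.
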